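(* Let $(A,S)$ be a weighted quiver with potential, with weights in a group $G$, with vertex set $Q_0=\{1,\dots,n\}$, and let $V_g^{ij}\subseteq e_iA_ge_j$ and $A_{triv}=\bigoplus V_g^{ij}$ be the trivial part determined by $S$. Choose a vector space complement $W_g^{ij}$ of $V_g^{ij}$ in $e_iA_ge_j$ for all $i,j\in Q_0$, $g\in G$, and let $W=\bigoplus_{i,j,g}W_g^{ij}\cong A_{red}=A/A_{triv}$. Then there exists a $G$-graded unitriangular automorphism $\varphi$ of $R\langle\langle A\rangle\rangle$ such that $\varphi(A,S)$ is cyclically equivalent to $(A_{triv},S_{triv})\oplus(A_{red},S_{red})$; that is, $\varphi(S)$ is cyclically equivalent to $S_{triv}+S_{red}$, where $S_{triv}=S^{(2)}$ is the degree $2$ part of $S$ and $S_{red}$ is a potential in $R\langle\langle W\rangle\rangle_{cyc}$ all of whose terms have degree $\ge 3$.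
   Context: Let $G$ be a group and $Q=(Q_0,Q_1,wt)$ a finite quiver without loops, with vertices $Q_0=\{1,\dots,n\}$, arrows $Q_1$ and weight function $wt:Q_1\to G$. Let $R=\mathbb C^{Q_0}$ be the semisimple algebra with idempotents $e_1,\dots,e_n$, and $A=\mathbb C^{Q_1}=\bigoplus_{g\in G}A_g$ the arrow span, with $A_g$ spanned by the arrows of weight $g$. $A$ is an $R$-bimodule, $e_iAe_j$ being the span of arrows $i\to j$ (arrows are composed left to right). $A^d=A\otimes_R\cdots\otimes_RA$ ($d$ factors) is the span of paths of length $d$; the weight of a path is the product of the weights of its arrows in order, and $wt(e_i)=1$. The completed path algebra is $R\langle\langle A\rangle\rangle=\prod_{d\ge0}A^d$, graded by $G$ with $R\langle\langle A\rangle\rangle_g=\prod_d A^d_g$, where $A^d_g$ is spanned by length-$d$ paths of weight $g$; $\mathfrak m=\prod_{d\ge1}A^d$. A potential is an element of $R\langle\langle A\rangle\rangle_{cyc}=\prod_{d\ge1}A^d_{cyc}$, where $A^d_{cyc}$ is the span of the oriented cycles of length $d$ of weight $1$. Two potentials are cyclically equivalent if their difference lies in the closure of the span of elements $a_1a_2\cdots a_d-a_2\cdots a_da_1$ with $a_1\cdots a_d$ a cyclic path. A weighted quiver with potential $(A,S)$ consists of such a $Q$ (with arrow span $A$) and a potential $S$, no two terms of which are cyclically equivalent up to a scalar. A $G$-graded automorphism $\varphi$ of $R\langle\langle A\rangle\rangle$ is a $\mathbb C$-algebra automorphism that is the identity on $R$ and satisfies $\varphi(A_g)\subseteq R\langle\langle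 A\rangle\rangle_g$ for all $g$; it is unitriangular if it is the identity modulo $\mathfrak m^2$. Trivial part. Let $S^{(2)}$ be the degree $2$ part of $S$. Up to cyclic equivalence $S^{(2)}$ is a sum of elements $S_g^{ij}\in e_iA_ge_j\otimes e_jA_{g^{-1}}e_i$ with $i<j$, $g\in G$. Each $S_g^{ij}$ induces linear maps $(e_jA_{g^{-1}}e_i)^\ast\to e_iA_ge_j$ and $(e_iA_ge_j)^\ast\to e_jA_{g^{-1}}e_i$, whose images are denoted $V_g^{ij}$ and $V_{g^{-1}}^{ji}$ respectively. Set $A_{triv}=\bigoplus_{i<j,\,g\in G}\left(V_g^{ij}\oplus V_{g^{-1}}^{ji}\right)$, $S_{triv}=S^{(2)}$ (taken in its cyclically equivalent form $\sum_{i<j,g}S_g^{ij}$ when regarded as a potential on $A_{triv}$), and $A_{red}=A/A_{triv}$. A weighted quiver with potential is called reduced if its potential lies in $\mathfrak m^3$. $R\langle\langle W\rangle\rangle$ denotes the completed tensor algebra $\prod_d W^{\otimes_R d}$ viewed inside $R\langle\langle A\rangle\rangle$, and $R\langle\langle W\rangle\rangle_{cyc}$ its potentials. *)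

(* Defs.v *)
From HB Require Import structures.
From mathcomp Require Import all_boot all_order all_algebra.
From mathcomp Require Import boolp classical_sets.

Set Implicit Arguments.
Unset Strict Implicit.
Unset Printing Implicit Defensive.

Import GRing.Theory.
Local Open Scope classical_set_scope.
Local Open Scope ring_scope.

Record wquiver (G : groupType) (n : nat) := WQuiver {
  arrow : finType;
  src : arrow -> 'I_n;
  tgt : arrow -> 'I_n;
  wt : arrow -> G;
  noloop : forall a, src a != tgt a
}.

Section Paths.
Variables (G : groupType) (n : nat) (Q : wquiver G n).
Implicit Types (i j : 'I_n) (a b : arrow Q) (s t : seq (arrow Q)).

(* Arrows are composed left to right. *)
Fixpoint composable i s : bool :=
  if s is a :: s' then (src a == i) && composable (tgt a) s' else true.

Definition endpoint i s : 'I_n := last i (map (@tgt G n Q) s).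

(* A path is a starting vertex with a composable word of arrows; the vertex is
   recorded so that the empty words give the n distinct trivial paths. *)
Record qpath := QPath {
  pval : 'I_n * seq (arrow Q);
  _ : composable pval.1 pval.2
}.
HB.instance Definition _ := [isSub for pval].
HB.instance Definition _ := [Choice of qpath by <:].

Definition pstart (p : qpath) : 'I_n := (pval p).1.
Definition parrows (p : qpath) : seq (arrow Q) := (pval p).2.
Definition pend (p : qpath) : 'I_n := endpoint (pstart p) (parrows p).
Definition plen (p : qpath) : nat := size (parrows p).
Definition pwt (p : qpath) : G := (\prod_(a <- parrows p) wt a)%g.

Lemma composable_cat i s t :
  composable i (s ++ t) = composable i s && composable (endpoint i s) t.
Proof. by elim: s i => [|a s IHs] i //=; rewrite IHs andbA. Qed.

Lemma endpoint_cat i s t :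
  endpoint i (s ++ t) = endpoint (endpoint i s) t.
Proof. by rewrite /endpoint map_cat last_cat. Qed.

Lemma composableP (p : qpath) : composable (pstart p) (parrows p).
Proof. by case: p. Qed.

Fact ptake_proof k (p : qpath) : composable (pstart p) (take k (parrows p)).
Proof.
by have := composableP p; rewrite -{1}(cat_take_drop k (parrows p))
  composable_cat => /andP[].
Qed.

Fact pdrop_proof k (p : qpath) :
  composable (endpoint (pstart p) (take k (parrows p))) (drop k (parrows p)).
Proof.
by have := composableP p; rewrite -{1}(cat_take_drop k (parrows p))
  composable_cat => /andP[].
Qed.

Definition ptake k p : qpath := @QPath (_, _) (ptake_proof k p).
Definition pdrop k p : qpath := @QPath (_, _) (pdrop_proof k p).
Definition pnil i : qpath := @QPath (i, [::]) isT.

Fact parr_proof a : composable (src a) [:: a].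
Proof. by rewrite /= eqxx. Qed.
Definition parr a : qpath := @QPath (_, _) (parr_proof a).

Lemma qpathP (p q : qpath) :
  pstart p = pstart q -> parrows p = parrows q -> p = q.
Proof.
case: p q => [[i s] ?] [[j t] ?] /= ij st.
by apply: val_inj; exact: (congr2 pair ij st).
Qed.

End Paths.

(* An element of the completed path algebra is an arbitrary family of
   coefficients indexed by paths, since the quiver has finitely many paths of
   each length. *)
Record cpalg (K : fieldType) (G : groupType) (n : nat) (Q : wquiver G n) :=
  Series { coef : qpath Q -> K }.

Section Algebra.
Variables (K : fieldType) (G : groupType) (n : nat) (Q : wquiver G n).
Local Notation path := (qpath Q).
Local Notation alg := (cpalg K Q).
Implicit Types (x y z : alg) (p q : path).

HB.instance Definition _ := gen_eqMixin alg.
HB.instance Definition _ := gen_choiceMixin alg.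

Lemma cpalgP x y : coef x =1 coef y -> x = y.
Proof. by case: x y => [f] [g] /= fg; congr Series; apply/funext. Qed.

Definition cpzero : alg := Series (fun=> 0).
Definition cpopp x : alg := Series (fun p => - coef x p).
Definition cpadd x y : alg := Series (fun p => coef x p + coef y p).
Definition cpscale (c : K) x : alg := Series (fun p => c * coef x p).
Definition cpone : alg := Series (fun p => (plen p == 0%N)%:R).
Definition cpmul x y : alg :=
  Series (fun p =>
    \sum_(0 <= k < (plen p).+1) coef x (ptake k p) * coef y (pdrop k p)).

Fact cpaddA : associative cpadd.
Proof. by move=> x y z; apply: cpalgP => p /=; rewrite addrA. Qed.
Fact cpaddC : commutative cpadd.
Proof. by move=> x y; apply: cpalgP => p /=; rewrite addrC. Qed.
Fact cpadd0 : left_id cpzero cpadd.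
Proof. by move=> x; apply: cpalgP => p /=; rewrite add0r. Qed.
Fact cpaddN : left_inverse cpzero cpopp cpadd.
Proof. by move=> x; apply: cpalgP => p /=; rewrite addNr. Qed.

HB.instance Definition _ :=
  GRing.isZmodule.Build alg cpaddA cpaddC cpadd0 cpaddN.

Fact cpscaleA c d x : cpscale c (cpscale d x) = cpscale (c * d) x.
Proof. by apply: cpalgP => p /=; rewrite mulrA. Qed.
Fact cpscale1 : left_id 1 cpscale.
Proof. by move=> x; apply: cpalgP => p /=; rewrite mul1r. Qed.
Fact cpscaleDr : right_distributive cpscale +%R.
Proof. by move=> c x y; apply: cpalgP => p /=; rewrite mulrDr. Qed.
Fact cpscaleDl x : {morph cpscale^~ x : c d / c + d}.
Proof. by move=> c d; apply: cpalgP => p /=; rewrite mulrDl. Qed.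

HB.instance Definition _ := GRing.Zmodule_isLmodule.Build K alg
  cpscaleA cpscale1 cpscaleDr cpscaleDl.

Fact cpmulA : associative cpmul.
Proof.
move=> x y z; apply: cpalgP => p /=; set N := plen p.
pose F l k := coef x (ptake l p) * coef y (pdrop l (ptake k p)) *
  coef z (pdrop k p).
have -> : \sum_(0 <= k < N.+1) (\sum_(0 <= l < (plen (ptake k p)).+1)
      coef x (ptake l (ptake k p)) * coef y (pdrop l (ptake k p))) *
      coef z (pdrop k p) =
    \sum_(0 <= k < N.+1) \sum_(0 <= l < N.+1 | (l < k.+1)%N) F l k.
  apply: eq_big_nat => k /andP[_ ltk]; rewrite mulr_suml.
  have -> : plen (ptake k p) = k by rewrite /plen size_takel.
  rewrite (big_nat_widen _ _ N.+1) //.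
  apply: eq_bigr => l lek; rewrite /F; congr (coef x _ * _ * _).
  by apply: qpathP => //; rewrite /parrows /= take_takel.
rewrite (exchange_big_dep_nat xpredT) //=; apply: eq_big_nat => l /andP[_ ltl].
rewrite mulr_sumr -(big_nat_widenl l 0 _ xpredT) //.
have -> : plen (pdrop l p) = (N - l)%N by rewrite /plen size_drop.
rewrite -subSn // [RHS](_ : _ = \sum_(0 + l <= k < N.+1) F l k) // big_addn; apply: eq_big_nat => m _.
rewrite mulrA; congr (_ * coef y _ * coef z _).
  apply: qpathP; rewrite /pstart /parrows /=; last by rewrite take_drop.
  by rewrite take_takel ?leq_addl.
apply: qpathP; rewrite /pstart /parrows /=; last by rewrite drop_drop.
by rewrite -endpoint_cat addnC takeD.
Qed.

Lemma ptake0 p : ptake 0 p = pnil Q (pstart p).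
Proof. by apply: qpathP; rewrite /parrows //= take0. Qed.
Lemma pdrop0 p : pdrop 0 p = p.
Proof. by apply: qpathP; rewrite /pstart /parrows /= ?take0 ?drop0. Qed.
Lemma ptake_oversize p k : (plen p <= k)%N -> ptake k p = p.
Proof. by move=> kp; apply: qpathP; rewrite /parrows //= take_oversize. Qed.
Lemma pdrop_oversize p k : (plen p <= k)%N -> pdrop k p = pnil Q (pend p).
Proof.
move=> kp; apply: qpathP; rewrite /pstart /parrows /= ?drop_oversize //.
by rewrite take_oversize.
Qed.
Lemma plen_take k p : (k <= plen p)%N -> plen (ptake k p) = k.
Proof. exact: size_takel. Qed.
Lemma plen_drop k p : plen (pdrop k p) = (plen p - k)%N.
Proof. exact: size_drop. Qed.

Fact cpmul1x : left_id cpone cpmul.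
Proof.
move=> x; apply: cpalgP => p /=; rewrite big_nat_recl // big_nat big1 ?addr0.
  by rewrite ptake0 pdrop0 -[plen (pnil _ _)]/0%N eqxx mul1r.
by move=> k /andP[_ kp]; rewrite plen_take // mul0r.
Qed.

Fact cpmulx1 : right_id cpone cpmul.
Proof.
move=> x; apply: cpalgP => p /=; rewrite big_nat_recr // big_nat big1 /= ?add0r.
  by rewrite ptake_oversize // pdrop_oversize // -[plen (pnil _ _)]/0%N eqxx mulr1.
by move=> k kp; rewrite plen_drop subn_eq0 leqNgt kp mulr0.
Qed.

Fact cpmulDl : left_distributive cpmul +%R.
Proof.
move=> x y z; apply: cpalgP => p /=; rewrite -big_split /=.
by apply: eq_bigr => k _; rewrite mulrDl.
Qed.

Fact cpmulDr : right_distributive cpmul +%R.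
Proof.
move=> x y z; apply: cpalgP => p /=; rewrite -big_split /=.
by apply: eq_bigr => k _; rewrite mulrDr.
Qed.

(* No algType structure: it would require 1 != 0, which fails for n = 0. *)
HB.instance Definition _ :=
  GRing.Zmodule_isPzRing.Build alg cpmulA cpmul1x cpmulx1 cpmulDl cpmulDr.

Lemma cpscaleAl c x y : c *: (x * y) = (c *: x) * y.
Proof.
apply: cpalgP => p /=; rewrite mulr_sumr.
by apply: eq_bigr => k _; rewrite mulrA.
Qed.

Lemma cpscaleAr c x y : c *: (x * y) = x * (c *: y).
Proof.
apply: cpalgP => p /=; rewrite mulr_sumr.
by apply: eq_bigr => k _; rewrite mulrCA.
Qed.

Definition pelt p : alg := Series (fun q => (q == p)%:R).

Definition vertex i : alg := pelt (pnil Q i).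

Definition hcomp d x : alg :=
  Series (fun p => if plen p == d then coef x p else 0).

Definition hweight (g : G) : set alg :=
  [set x | forall p, coef x p != 0 -> pwt p = g].

Definition lspan (P : set alg) : set alg :=
  [set x | exists s : seq (K * alg),
     (forall c, c \in s -> P c.2) /\ x = \sum_(c <- s) c.1 *: c.2].

Definition maxideal : set alg := [set x | forall p, plen p = 0%N -> coef x p = 0].

Fixpoint maxideal_pow k : set alg :=
  if k is k'.+1 then lspan [set x * y | x in maxideal & y in maxideal_pow k']
  else setT.

(* Closure for the topology in which the powers of the ideal m of series
   without constant terms form a basis of neighbourhoods of 0. *)
Definition mclosure (P : set alg) : set alg :=
  [set x | forall k, exists2 y, P y & maxideal_pow k (x - y)].

End Algebra.

Section ArrowSpan.
Variables (K : fieldType) (G : groupType) (n : nat) (Q : wquiver G n).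
Local Notation alg := (cpalg K Q).
Implicit Types (i j : 'I_n) (g : G) (a b : arrow Q).

Definition aspan := {ffun arrow Q -> K^o}.
HB.instance Definition _ := Vector.on aspan.

Definition delta a : aspan := [ffun b => (b == a)%:R].

Definition arrow_elt a : alg := pelt K (parr a).

Definition aspan_elt (v : aspan) : alg := \sum_a (v a : K) *: arrow_elt a.

Definition arrows_from_to i j g : pred (arrow Q) :=
  [pred a | [&& src a == i, tgt a == j & wt a == g]].

Definition aspan_wt g : {vspace aspan} :=
  <<[seq delta a | a <- enum [pred a : arrow Q | wt a == g]]>>%VS.

Definition eAe i j g : {vspace aspan} :=
  <<[seq delta a | a <- enum (arrows_from_to i j g)]>>%VS.

(* The finitely many g with A_g nonzero; sums over the group are taken here. *)
Definition weights : seq G := undup [seq wt a | a <- enum (arrow Q)].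

Fixpoint tensor_pow (W : {vspace aspan}) d : set alg :=
  if d is d'.+1 then
    lspan [set aspan_elt w * y | w in [set w | w \in W] & y in tensor_pow W d']
  else lspan (range (@vertex K G n Q)).

(* The closed subalgebra generated over R by an R-subbimodule W of A. *)
Definition completed_tensor (W : {vspace aspan}) : set alg :=
  [set x | forall d, tensor_pow W d (hcomp d x)].

End ArrowSpan.

Section Potentials.
Variables (K : fieldType) (G : groupType) (n : nat) (Q : wquiver G n).
Local Notation alg := (cpalg K Q).
Local Notation A := (aspan K Q).
Implicit Types (S x y : alg) (i j : 'I_n) (g : G) (a b : arrow Q).

Definition potential : set alg :=
  [set S | forall p, coef S p != 0 ->
     [&& (0 < plen p)%N, pend p == pstart p & pwt p == 1%g]].

Definition word_elt (s : seq (arrow Q)) : alg := \prod_(a <- s) arrow_elt K a.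

Definition rotation_diffs : set alg :=
  [set x | exists a s, cycle (fun b c => tgt b == src c) (a :: s) /\
     x = word_elt (a :: s) - word_elt (rcons s a)].

Definition cyc_equiv x y : Prop := mclosure (lspan rotation_diffs) (x - y).

Definition weighted_qp S : Prop :=
  potential S /\
  forall p q, p != q -> coef S p != 0 -> coef S q != 0 ->
    ~ exists2 c : K, c != 0 &
        cyc_equiv (coef S p *: pelt K p) (c *: (coef S q *: pelt K q)).

(* The coefficient of the word ab, or 0 if ab is not a path. *)
Definition coef2 S a b : K :=
  oapp (coef S) 0 (insub (src a, [:: a; b]) : option (qpath Q)).

(* For i < j, collecting the terms ab and ba of S^(2) into the cyclically
   equivalent form ab, with a : i -> j and b : j -> i, gives the coefficient of
   ab in S_g^{ij}. It is symmetric in a and b. *)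
Definition sym_coef2 S a b : K := coef2 S a b + coef2 S b a.

Definition Spart S i j g : alg :=
  \sum_(a in arrows_from_to i j g) \sum_(b in arrows_from_to j i g^-1%g)
    sym_coef2 S a b *: (arrow_elt K a * arrow_elt K b).

Definition Striv S : alg :=
  \sum_(i < n) \sum_(j < n | (i < j)%N) \sum_(g <- weights Q) Spart S i j g.

(* For i < j this is the map (e_j A_{g^-1} e_i)^* -> e_i A_g e_j induced by
   S_g^{ij}; for j < i it is, by symmetry of sym_coef2, the second map
   (e_j A_h e_i)^* -> e_i A_{h^-1} e_j induced by S_h^{ji}, where h = g^-1. *)
Definition contraction S i j g (f : 'Hom(subvs_of (eAe K Q j i g^-1%g), K^o)) : A :=
  \sum_(a in arrows_from_to i j g) \sum_(b in arrows_from_to j i g^-1%g)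
    (sym_coef2 S a b * f (vsproj _ (delta K b))) *: delta K a.

Fact contraction_is_linear S i j g : linear (@contraction S i j g).
Proof.
move=> c u v; rewrite /contraction scaler_sumr -big_split.
apply: eq_bigr => a _ /=; rewrite scaler_sumr -big_split.
apply: eq_bigr => b _ /=.
rewrite add_lfunE scale_lfunE mulrDr scalerDl scalerA; congr (_ *: _ + _).
by rewrite mulrCA.
Qed.
HB.instance Definition _ S i j g :=
  GRing.isLinear.Build K 'Hom(subvs_of (eAe K Q j i g^-1%g), K^o) A *:%R
    (@contraction S i j g) (@contraction_is_linear S i j g).

Definition Vtriv S i j g : {vspace A} := limg (linfun (@contraction S i j g)).

Definition Atriv S : {vspace A} :=
  (\sum_(i < n) \sum_(j < n | (i < j)%N) \sum_(g <- weights Q)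
     (Vtriv S i j g + Vtriv S j i g^-1%g))%VS.

Definition Wtotal (W : 'I_n -> 'I_n -> G -> {vspace A}) : {vspace A} :=
  (\sum_(i < n) \sum_(j < n) \sum_(g <- weights Q) W i j g)%VS.

Definition potential_on (W : {vspace A}) : set alg :=
  completed_tensor W `&` potential.

Record graded_automorphism (phi : alg -> alg) : Prop := {
  gaut_linear : linear phi;
  gaut_mul : monoid_morphism phi;
  gaut_bij : bijective phi;
  gaut_vertex : forall i, phi (vertex K Q i) = vertex K Q i;
  gaut_graded : forall g v, v \in aspan_wt K Q g -> hweight g (phi (aspan_elt v))
}.

Definition unitriangular (phi : alg -> alg) : Prop :=
  forall x, maxideal_pow 2 (phi x - x).

End Potentials.

(* Main.v *)
From HB Require Import structures.
Require Import Defs.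
From mathcomp Require Import all_boot all_order all_algebra.
From mathcomp Require Import boolp classical_sets reals.
From mathcomp Require Import complex zify.

Set Implicit Arguments.
Unset Strict Implicit.
Unset Printing Implicit Defensive.

Import GRing.Theory.
Local Open Scope classical_set_scope.
Local Open Scope ring_scope.

(** The automorphism substitutes for each arrow [b] a series [b + f b], and
    [f] is found by solving one fixed-point equation, instead of composing
    infinitely many automorphisms.

    Write [S = S2 + S3], with [S2] the quadratic part and [S3] of order at
    least 3. Substituting [b + f b] for [b] turns [S] into [S2 + L f + X f],
    where [L f] is linear in [f], and [X f], of order at least 3, collects the
    terms of [S2] that are quadratic in [f] and all of what [S3] becomes. Up to
    cyclic equivalence [L f] is the sum over [b] of [d_b (f b)], where
    [d_b = sum_a s(a,b) a] is the derivative of [S2] in the direction [b] and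
    [s] the symmetrised matrix of coefficients ([cyc0_linear_part]). By the
    definition of [V_g^ij] as the image of a contraction, the [d_b] are
    precisely what spans the trivial part ([qderiv_Vtriv], [Vtriv_qderiv]).

    Every cyclic series [X] is cyclically equivalent to a sum of terms
    [d_b (T_b X)] plus the image [w X] of [X] when each arrow is replaced by
    its component in [W]: split the letters of a word one after the other into
    their two components and, at the first letter taken in the trivial part,
    rotate the word so that this letter comes first ([cyc0_cder]). Hence if
    [f b = - T_b (X f)] for all [b], the [d_b]-terms cancel and the image of [S]
    is cyclically equivalent to [S2 + w (X f)], so that [w (X f)] is the reduced
    part ([splitting]). The operator [T_b], which is [cder], lowers the order by
    one, but changing [f] in order [k] changes [X f] only in order [k + 2],
    because [f b] has order at least 2 and [S3] order at least 3. So the equation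
    for [f] is a contraction for the filtration by length and has a solution
    ([fixlimE]).

    That [S2] becomes a tensor in the trivial part alone, on both sides, is a
    symmetry argument ([Spart_triv]).

    Series are handled through their left quotients by arrows ([ldiv]):
    [x = x_0 + sum_a a (ldiv a x)] ([decomp]). Substitution is the solution of
    the corresponding recursion, and its properties are proved by induction on
    the order up to which two series agree; paths are listed only in order to
    approximate a series by finite sums. *)

(** * Left division by arrows *)

Section Division.
Variables (K : fieldType) (G : groupType) (n : nat) (Q : wquiver G n).
Local Notation path := (qpath Q).
Local Notation alg := (cpalg K Q).
Implicit Types (x y z : alg) (p q : path) (i j : 'I_n) (a b : arrow Q).

(** The default value [p] stands for the case in which [a] does not end where
    [p] starts. *)
Definition pcons a p : path := insubd p (src a, a :: parrows p).

Lemma val_pcons a p :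
  tgt a = pstart p -> pval (pcons a p) = (src a, a :: parrows p).
Proof.
move=> ap; rewrite [pval _](val_insubd p) /= eqxx ap.
by rewrite composableP.
Qed.

Lemma pstart_pcons a p : tgt a = pstart p -> pstart (pcons a p) = src a.
Proof. by move=> ap; rewrite /pstart val_pcons. Qed.

Lemma parrows_pcons a p : tgt a = pstart p -> parrows (pcons a p) = a :: parrows p.
Proof. by move=> ap; rewrite /parrows val_pcons. Qed.

Lemma plen_pcons a p : tgt a = pstart p -> plen (pcons a p) = (plen p).+1.
Proof. by move=> ap; rewrite /plen parrows_pcons. Qed.

Lemma pend_pcons a p : tgt a = pstart p -> pend (pcons a p) = pend p.
Proof.
by move=> ap; rewrite /pend /endpoint parrows_pcons // pstart_pcons //= ap.
Qed.

Lemma pwt_pcons a p : tgt a = pstart p -> pwt (pcons a p) = (wt a * pwt p)%g.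
Proof. by move=> ap; rewrite /pwt parrows_pcons // big_cons. Qed.

Lemma qpath_ind (P : path -> Prop) :
  (forall i, P (pnil Q i)) ->
  (forall a p, tgt a = pstart p -> P p -> P (pcons a p)) -> forall p, P p.
Proof.
move=> P0 Pc [[i s] c]; elim: s i c => [|a s IH] i c.
  by rewrite (_ : QPath c = pnil Q i) //; apply: qpathP.
have := c; rewrite /= => /andP[/eqP ai cs].
have /= -> : QPath c = pcons a (@QPath _ _ _ (tgt a, s) cs); last exact: Pc.
by apply: qpathP; [rewrite pstart_pcons|rewrite parrows_pcons].
Qed.

Definition c0 i x : K := coef x (pnil Q i).
Arguments c0 : simpl never.

(** The series [y] with [x = a y + (terms that do not start with a)]. *)
Definition ldiv a x : alg :=
  Series (fun p => if tgt a == pstart p then coef x (pcons a p) else 0).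

Lemma scoefD x y p : coef (x + y) p = coef x p + coef y p. Proof. by []. Qed.
Lemma scoefN x p : coef (- x) p = - coef x p. Proof. by []. Qed.
Lemma scoefB x y p : coef (x - y) p = coef x p - coef y p. Proof. by []. Qed.
Lemma scoefZ c x p : coef (c *: x) p = c * coef x p. Proof. by []. Qed.
Lemma scoef0 p : coef (0 : alg) p = 0. Proof. by []. Qed.
Lemma scoef_sum I (r : seq I) (P : pred I) (F : I -> alg) p :
  coef (\sum_(k <- r | P k) F k) p = \sum_(k <- r | P k) coef (F k) p.
Proof. exact: (big_morph (fun x => coef x p) (fun x y => scoefD x y p) (scoef0 p)). Qed.

Fact c0_is_linear i : linear (c0 i : alg -> K^o).
Proof. by []. Qed.
HB.instance Definition _ i :=
  GRing.isLinear.Build K alg K^o *:%R (c0 i) (@c0_is_linear i).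

Lemma c0Z i c x : c0 i (c *: x) = c * c0 i x. Proof. by []. Qed.
Lemma c0_sum i I (r : seq I) (P : pred I) (F : I -> alg) :
  c0 i (\sum_(k <- r | P k) F k) = \sum_(k <- r | P k) c0 i (F k).
Proof. exact: scoef_sum. Qed.

Fact ldiv_is_linear a : linear (ldiv a).
Proof.
move=> c x y; apply: cpalgP => p /=; case: ifP => // _.
by rewrite mulr0 addr0.
Qed.
HB.instance Definition _ a :=
  GRing.isLinear.Build K alg alg *:%R (ldiv a) (@ldiv_is_linear a).

Lemma series_eq x y :
  (forall i, c0 i x = c0 i y) -> (forall a, ldiv a x = ldiv a y) -> x = y.
Proof.
move=> xy0 xyS; apply: cpalgP => p; elim/qpath_ind: p => [i|a p ap _]; first exact: xy0.
by have := congr1 (fun z => coef z p) (xyS a); rewrite /= ap eqxx.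
Qed.

Lemma c0M i x y : c0 i (x * y) = c0 i x * c0 i y.
Proof.
rewrite /c0 [LHS]/= -[plen _]/0%N big_nat1 ptake_oversize // pdrop_oversize //.
Qed.

Lemma ldivM a x y : ldiv a (x * y) = c0 (src a) x *: ldiv a y + ldiv a x * y.
Proof.
apply: cpalgP => p; rewrite scoefD scoefZ /=; case: eqP => [ap|nap]; last first.
  by rewrite mulr0 add0r big1_seq // => k _; rewrite mul0r.
rewrite plen_pcons // big_nat_recl // ptake0 pdrop0 pstart_pcons //.
congr (_ + _); apply: eq_bigr => k _.
congr (coef x _ * coef y _); apply: qpathP.
- by rewrite pstart_pcons // -(pstart_pcons ap).
- by rewrite [LHS]/parrows /= -/(parrows _) !parrows_pcons.
- rewrite /pstart /= -/(parrows _) -/(pstart _) parrows_pcons // pstart_pcons //=.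
  by rewrite /endpoint /= ap.
- by rewrite [LHS]/parrows /= -/(parrows _) parrows_pcons.
Qed.

Lemma c0_vertex i j : c0 i (vertex K Q j) = (i == j)%:R.
Proof.
rewrite /c0 /=; congr (_ %:R); congr nat_of_bool.
by apply/eqP/eqP => [/(congr1 (@pstart _ _ _))|->].
Qed.

Lemma ldiv_vertex a i : ldiv a (vertex K Q i) = 0.
Proof.
apply: cpalgP => p /=; case: eqP => // ap; case: eqP => // /(congr1 (@plen _ _ _)).
by rewrite plen_pcons.
Qed.

Lemma c0_arrow i a : c0 i (arrow_elt K a) = 0.
Proof. by rewrite /c0 /=; case: eqP => // /(congr1 (@plen _ _ _)). Qed.

Lemma ldiv_arrow a b :
  ldiv a (arrow_elt K b) = (a == b)%:R *: vertex K Q (tgt a).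
Proof.
apply: cpalgP => p; rewrite scoefZ /=; case: eqP => [ap|nap]; last first.
  by case: (p =P pnil Q _) nap => [-> //|]; rewrite mulr0.
rewrite -natrM mulnb; congr (_ %:R); congr nat_of_bool.
apply/eqP/andP => [e|[/eqP-> /eqP->]].
  have := congr1 (@parrows _ _ _) e; rewrite parrows_pcons // => -[<- p0].
  by split=> //; apply/eqP/qpathP; rewrite // -ap.
by apply: qpathP; [rewrite pstart_pcons | rewrite parrows_pcons].
Qed.

Lemma ldiv_one a : ldiv a 1 = 0.
Proof.
by apply: cpalgP => p /=; case: eqP => // ap; rewrite plen_pcons.
Qed.

Lemma sum_vertex : \sum_i vertex K Q i = 1.
Proof.
apply: series_eq => [i|a].
  rewrite linear_sum /= (bigD1 i) //= c0_vertex eqxx big1 ?addr0 // => j ji.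
  by rewrite c0_vertex eq_sym (negPf ji).
by rewrite linear_sum /= ldiv_one big1 // => i _; rewrite ldiv_vertex.
Qed.

Lemma coef_vertexM i x p :
  coef (vertex K Q i * x) p = (pstart p == i)%:R * coef x p.
Proof.
elim/qpath_ind: p => [j|b p bp _]; first by rewrite -/(c0 j _) c0M c0_vertex.
have := congr1 (fun z => coef z p) (ldivM b (vertex K Q i) x).
rewrite ldiv_vertex mul0r addr0 c0_vertex scoefZ /= bp eqxx => ->.
by rewrite pstart_pcons.
Qed.

Lemma vertex_ldiv a x : vertex K Q (tgt a) * ldiv a x = ldiv a x.
Proof.
apply: cpalgP => p; rewrite coef_vertexM /= eq_sym.
by case: ifP; rewrite ?mulr0 ?mul1r.
Qed.

Definition cpart x : alg := \sum_i c0 i x *: vertex K Q i.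

Lemma c0_cpart i x : c0 i (cpart x) = c0 i x.
Proof.
rewrite linear_sum /= (bigD1 i) //= linearZ /= c0_vertex eqxx big1.
  by rewrite addr0; exact: mulr1.
by move=> j ji; rewrite linearZ /= c0_vertex eq_sym (negPf ji); exact: mulr0.
Qed.

Lemma ldiv_cpart a x : ldiv a (cpart x) = 0.
Proof. by rewrite linear_sum /= big1 // => i _; rewrite linearZ /= ldiv_vertex scaler0. Qed.

Lemma ldiv_arrowM a b x :
  ldiv a (arrow_elt K b * x) = (a == b)%:R *: (vertex K Q (tgt a) * x).
Proof. by rewrite ldivM c0_arrow scale0r add0r ldiv_arrow cpscaleAl. Qed.

(** The recursion behind the operators below, and behind the inductions on the
    order up to which two series agree. *)
Lemma decomp x : x = cpart x + \sum_a arrow_elt K a * ldiv a x.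
Proof.
apply: series_eq => [i|a]; rewrite linearD /=.
  by rewrite c0_cpart linear_sum /= big1 ?addr0 // => a _; rewrite c0M c0_arrow mul0r.
rewrite ldiv_cpart add0r linear_sum /= (bigD1 a) //= ldiv_arrowM eqxx vertex_ldiv.
rewrite scale1r big1 ?addr0 // => b ba.
by rewrite ldiv_arrowM eq_sym (negPf ba) scale0r.
Qed.

Fact cpart_is_linear : linear cpart.
Proof.
move=> c x y; rewrite /cpart scaler_sumr -big_split; apply: eq_bigr => i _ /=.
by rewrite scalerA -scalerDl.
Qed.
HB.instance Definition _ :=
  GRing.isLinear.Build K alg alg *:%R cpart cpart_is_linear.

Lemma cpart_vertex i : cpart (vertex K Q i) = vertex K Q i.
Proof.
by apply: series_eq => [j|a]; rewrite ?c0_cpart // ldiv_cpart ldiv_vertex.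
Qed.

Lemma cpart_one : cpart 1 = 1.
Proof.
by apply: series_eq => [j|a]; rewrite ?c0_cpart // ldiv_cpart ldiv_one.
Qed.

Lemma cpart_arrow a : cpart (arrow_elt K a) = 0.
Proof. by rewrite /cpart big1 // => i _; rewrite c0_arrow scale0r. Qed.

Lemma cpartM x y : cpart (x * y) = cpart x * cpart y.
Proof.
apply: series_eq => [j|a]; rewrite ?(c0M, c0_cpart) // ldivM !ldiv_cpart.
by rewrite scaler0 mul0r addr0.
Qed.

(** * The filtration by length *)

Definition deep k x := forall p, (plen p < k)%N -> coef x p = 0.

Lemma deep_eq x y : (forall k, deep k (x - y)) -> x = y.
Proof.
move=> xy; apply: cpalgP => p; apply/eqP; rewrite -subr_eq0; apply/eqP.
exact: (xy (plen p).+1 p (ltnSn _)).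
Qed.

Lemma deep0 x : deep 0 x. Proof. by []. Qed.
Lemma deep_zero k : deep k 0. Proof. by []. Qed.
Lemma deepD k x y : deep k x -> deep k y -> deep k (x + y).
Proof. by move=> dx dy p kp; rewrite scoefD dx // dy // addr0. Qed.
Lemma deepZ k c x : deep k x -> deep k (c *: x).
Proof. by move=> dx p kp; rewrite scoefZ dx // mulr0. Qed.
Lemma deepN k x : deep k x -> deep k (- x).
Proof. by move=> dx p kp; rewrite scoefN dx // oppr0. Qed.
Lemma deepB k x y : deep k x -> deep k y -> deep k (x - y).
Proof. by move=> dx dy; apply/deepD/deepN. Qed.
Lemma deepBC k x y : deep k (x - y) -> deep k (y - x).
Proof. by move=> /deepN; rewrite opprB. Qed.
Lemma deep_trans k x y z : deep k (x - y) -> deep k (y - z) -> deep k (x - z).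
Proof. by move=> dxy dyz; have := deepD dxy dyz; rewrite addrA subrK. Qed.
Lemma deep_sum k I (r : seq I) (P : pred I) (F : I -> alg) :
  (forall t, P t -> deep k (F t)) -> deep k (\sum_(t <- r | P t) F t).
Proof. by move=> dF; apply: big_ind => //; exact: deepD. Qed.
Lemma deep_leq k l x : (k <= l)%N -> deep l x -> deep k x.
Proof. by move=> kl dx p kp; apply: dx; apply: leq_trans kl. Qed.

Lemma deepM k l x y : deep k x -> deep l y -> deep (k + l) (x * y).
Proof.
move=> dx dy p kp; rewrite [LHS]/= big_nat big1 // => m /andP[_ mp].
case: (ltnP m k) => mk; first by rewrite dx ?mul0r // plen_take.
rewrite (dy (pdrop m p)) ?mulr0 // plen_drop.
by rewrite ltn_subLR // (leq_trans kp) // leq_add2r.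
Qed.

Lemma deep_ldiv k a x : deep k x -> deep k.-1 (ldiv a x).
Proof.
move=> dx p kp /=; case: eqP => // ap; apply: dx; rewrite plen_pcons //.
by case: k kp.
Qed.

Lemma deepS k x :
  (forall i, c0 i x = 0) -> (forall a, deep k (ldiv a x)) -> deep k.+1 x.
Proof.
move=> x0 xS p; elim/qpath_ind: p => [i _|a p ap _]; first exact: x0.
by rewrite plen_pcons // ltnS => /(xS a); rewrite /= ap eqxx.
Qed.

Lemma deep_arrow a : deep 1 (arrow_elt K a).
Proof. by apply: deepS => // i; rewrite c0_arrow. Qed.

Lemma deep_cpart k x : deep k.+1 x -> cpart x = 0.
Proof. by move=> dx; rewrite /cpart big1 // => i _; rewrite /c0 dx // scale0r. Qed.

(** Limits of Cauchy sequences, with the modulus that all sequences below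
    satisfy. *)
Definition series_lim (u : nat -> alg) : alg :=
  Series (fun p => coef (u (plen p).+1) p).

Lemma deep_lim u : (forall k, deep k (u k.+1 - u k)) ->
  forall k, deep k (series_lim u - u k).
Proof.
move=> du k p; elim: k => // k IH; rewrite ltnS leq_eqVlt => /orP[/eqP<-|pk].
  by rewrite scoefB /= subrr.
have /eqP := du k p pk; rewrite scoefB subr_eq0 => /eqP uk.
by rewrite uk -scoefB IH.
Qed.

Section FixedPoint.
Variables (T : Type) (Psi : (T -> alg) -> (T -> alg)).
Hypothesis contr : forall k u v, (forall t, deep k (u t - v t)) ->
  forall t, deep k.+1 (Psi u t - Psi v t).

(** The limit of the iterates solves the equation for any seed [u0]; a good seed
    makes the iterates themselves meaningful, as in [subst]. *)
Definition fixlim (u0 : T -> alg) t : alg := series_lim (fun k => iter k Psi u0 t).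

Lemma deep_fixlim u0 k t : deep k (fixlim u0 t - iter k Psi u0 t).
Proof.
apply: (deep_lim (u := fun k => iter k Psi u0 t)) => {}k.
elim: k t => // k IH t; rewrite (iterS k.+1) (iterS k); exact: contr.
Qed.

Lemma fixlimE u0 t : fixlim u0 t = Psi (fixlim u0) t.
Proof.
apply: deep_eq => k; apply: (deep_leq (leqnSn k)).
apply: deep_trans (@deep_fixlim u0 k.+1 t) _; rewrite iterS.
by apply: contr => t'; apply/deepBC/deep_fixlim.
Qed.

End FixedPoint.

End Division.

Arguments c0 : simpl never.

(** * Series supported on paths of given ends and weight *)

Section Homogeneous.
Variables (K : fieldType) (G : groupType) (n : nat) (Q : wquiver G n).
Local Notation path := (qpath Q).
Local Notation alg := (cpalg K Q).
Implicit Types (x y z : alg) (p q : path) (i j : 'I_n) (a b : arrow Q) (g h : G).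

Definition homog i j g x := forall p, coef x p != 0 ->
  [/\ pstart p = i, pend p = j & pwt p = g].

Lemma homog_zero i j g : homog i j g 0.
Proof. by move=> p; rewrite scoef0 eqxx. Qed.

Lemma homogD i j g x y : homog i j g x -> homog i j g y -> homog i j g (x + y).
Proof.
move=> hx hy p; rewrite scoefD; case: (eqVneq (coef x p) 0) => [->|/hx //].
by rewrite add0r => /hy.
Qed.

Lemma homogZ i j g c x : homog i j g x -> homog i j g (c *: x).
Proof. by move=> hx p; rewrite scoefZ mulf_eq0 negb_or => /andP[_ /hx]. Qed.

Lemma homogN i j g x : homog i j g x -> homog i j g (- x).
Proof. by move=> hx p; rewrite scoefN oppr_eq0 => /hx. Qed.

Lemma homog_sum i j g I (r : seq I) (P : pred I) (F : I -> alg) :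
  (forall t, P t -> homog i j g (F t)) -> homog i j g (\sum_(t <- r | P t) F t).
Proof. by move=> hF; apply: big_ind hF => //; [exact: homog_zero|exact: homogD]. Qed.

Lemma pwt_take_drop k p : (pwt (ptake k p) * pwt (pdrop k p))%g = pwt p.
Proof. by rewrite /pwt -big_cat /= -{1}(cat_take_drop k (parrows p)). Qed.

Lemma pend_drop k p : pend (pdrop k p) = pend p.
Proof.
rewrite /pend {1}/parrows /= {1}/pstart /= -endpoint_cat.
by rewrite -/(parrows p) cat_take_drop.
Qed.

Lemma homogM i j k g h x y :
  homog i j g x -> homog j k h y -> homog i k (g * h)%g (x * y).
Proof.
move=> hx hy p xyp.
have [m /andP[xm ym]] : exists m, (coef x (ptake m p) != 0) && (coef y (pdrop m p) != 0).
  apply: contrapT => nm; case/eqP: xyp; rewrite [LHS]/= big1 // => m _.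
  by apply/eqP; rewrite mulf_eq0 -[_ || _]negbK negb_or; apply/negP => ?; apply: nm; exists m.
have [<- _ <-] := hx _ xm; have [_ <- <-] := hy _ ym.
by rewrite pwt_take_drop pend_drop.
Qed.

Lemma homog_vertex i : homog i i 1%g (vertex K Q i).
Proof.
move=> p /=; case: (p =P _) => [->|]; last by rewrite eqxx.
by rewrite /pwt big_nil.
Qed.

Lemma homog_arrow a : homog (src a) (tgt a) (wt a) (arrow_elt K a).
Proof.
move=> p /=; case: (p =P _) => [->|]; last by rewrite eqxx.
by rewrite /pwt big_seq1.
Qed.

Lemma homog_ldiv i j g a x :
  homog i j g x -> homog (tgt a) j ((wt a)^-1 * g)%g (ldiv a x).
Proof.
move=> hx p /=; case: (tgt a =P _) => [ap|]; last by rewrite eqxx.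
by move=> /hx[]; rewrite pend_pcons // pwt_pcons // => _ <- <-; rewrite mulKg.
Qed.

Lemma ldiv_homog0 i j g a x : homog i j g x -> src a != i -> ldiv a x = 0.
Proof.
move=> hx ai; apply: cpalgP => p /=; case: eqP => // ap.
apply: contra_neq_eq ai => /hx[<- _ _].
by rewrite pstart_pcons.
Qed.

Lemma homog_cpart i j g x : homog i j g x -> homog i j g (cpart x).
Proof.
move=> hx; apply: homog_sum => k _; case: (eqVneq (c0 k x) 0) => [->|/hx].
  by rewrite scale0r; exact: homog_zero.
rewrite /pstart /pend /pwt big_nil /endpoint /= => -[<- <- <-].
exact/homogZ/homog_vertex.
Qed.

Lemma homog_vertexl i j g x : homog i j g x -> vertex K Q i * x = x.
Proof.
move=> hx; apply: series_eq => [k|a].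
  rewrite c0M c0_vertex; case: (eqVneq k i) => ki; first by rewrite mul1r.
  rewrite mul0r; apply/esym; apply: contra_neq_eq ki => /hx[].
  by rewrite /pstart.
rewrite ldivM ldiv_vertex mul0r addr0 c0_vertex.
case: (eqVneq (src a) i) => ai; first by rewrite scale1r.
by rewrite (ldiv_homog0 hx ai) scaler0.
Qed.

Lemma homog_vertexr i j g x : homog i j g x -> x * vertex K Q j = x.
Proof.
move=> hx; rewrite -[RHS]mulr1 -sum_vertex (bigD1 j) //= mulrDr.
rewrite mulr_sumr big1 ?addr0 // => k kj; apply: cpalgP => p.
rewrite [LHS]/= scoef0 big_nat big1 // => m /andP[_ mp].
case: (eqVneq (coef x (ptake m p)) 0) => [->|/hx[_ ej _]]; first by rewrite mul0r.
case: eqP => [e|]; last by rewrite mulr0.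
by case/eqP: kj; rewrite -ej -[k]/(pstart (pnil Q k)) -e.
Qed.

Lemma homog_lim i j g x :
  (forall k, exists2 y, homog i j g y & deep k (x - y)) -> homog i j g x.
Proof.
move=> hx p; have [y hy /(_ p (ltnSn _)) /eqP] := hx (plen p).+1.
by rewrite scoefB subr_eq0 => /eqP->; exact: hy.
Qed.

Lemma homog_pelt p : homog (pstart p) (pend p) (pwt p) (pelt K p).
Proof. by move=> q /=; case: (q =P p) => [->|]; rewrite ?eqxx. Qed.

Lemma vertex_homog i x :
  (forall p, coef x p != 0 -> pend p = pstart p /\ pwt p = 1%g) ->
  homog i i 1%g (vertex K Q i * x).
Proof.
move=> cx p; rewrite coef_vertexM; case: (eqVneq (pstart p) i) => [<-|_].
  by rewrite mul1r => /cx[-> ->].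
by rewrite mul0r eqxx.
Qed.

(** ** Finite truncations *)

Fixpoint words k : seq (seq (arrow Q)) :=
  if k is k'.+1 then [::] :: [seq a :: s | a <- enum (arrow Q), s <- words k']
  else [::].

Lemma mem_words k s : (size s < k)%N -> s \in words k.
Proof.
elim: k s => // k IH [|a s] //=; rewrite ltnS => /IH sk.
by rewrite inE; apply/allpairsP; exists (a, s); rewrite mem_enum.
Qed.

Definition paths_below k : seq path :=
  undup (pmap insub [seq (i, s) | i <- enum 'I_n, s <- words k]).

Lemma mem_paths_below k p : (plen p < k)%N -> p \in paths_below k.
Proof.
move=> pk; rewrite mem_undup mem_pmap_sub; apply/allpairsP.
by exists (pstart p, parrows p); split; rewrite /= ?mem_enum ?mem_words //; case: p {pk} => -[].
Qed.

Lemma deep_trunc k x : deep k (x - \sum_(p <- paths_below k) coef x p *: pelt K p).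
Proof.
move=> q qk; rewrite scoefB scoef_sum (bigD1_seq q) ?undup_uniq ?mem_paths_below //=.
rewrite eqxx mulr1 big1 ?addr0 ?subrr // => p pq.
by rewrite eq_sym (negPf pq) mulr0.
Qed.

(** Modulo long paths a series is a finite combination of paths of its own
    type, so that a linear property may be tested on those. *)
Lemma homog_ind k (P : alg -> Prop) i j g :
  (forall x, deep k x -> P x) -> (forall x y, P x -> P y -> P (x + y)) ->
  (forall c x, P x -> P (c *: x)) ->
  (forall p, pstart p = i -> pend p = j -> pwt p = g -> P (pelt K p)) ->
  forall x, homog i j g x -> P x.
Proof.
move=> Pk PD PZ Pp x hx.
rewrite -(subrK (\sum_(p <- paths_below k) coef x p *: pelt K p) x).
apply: (PD); first exact/Pk/deep_trunc.
apply: (big_ind P) => [||p _]; [exact/Pk/deep_zero|exact: PD|].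
case: (eqVneq (coef x p) 0) => [->|/hx[pi pj pg]]; first by rewrite scale0r; exact: Pk.
exact/PZ/Pp.
Qed.

(** ** Powers of the maximal ideal *)

(** Peeling off first arrows writes a series without short terms as a finite sum
    of products of elements of the maximal ideal. *)
Lemma maxideal_pow_deep k x : deep k x -> maxideal_pow k x.
Proof.
elim: k x => [//|k IH] x dx.
exists [seq (1, arrow_elt K a * ldiv a x) | a <- enum (arrow Q)]; split.
  move=> _ /mapP[a _ ->] /=; exists (arrow_elt K a).
    by move=> p p0; apply: deep_arrow; rewrite p0.
  by exists (ldiv a x) => //; exact/IH/(deep_ldiv a dx).
rewrite big_map big_enum /= {1}[x]decomp (deep_cpart dx) add0r.
by apply: eq_bigr => a _; rewrite scale1r.
Qed.

End Homogeneous.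

Arguments homog_vertex K {G n Q} i.
Arguments homog_arrow K {G n Q} a.
Arguments homog_pelt K {G n Q} p.

(** * Cyclic equivalence *)

Section Cyclic.
Variables (K : fieldType) (G : groupType) (n : nat) (Q : wquiver G n).
Local Notation path := (qpath Q).
Local Notation alg := (cpalg K Q).
Implicit Types (x y z : alg) (p q : path) (i j : 'I_n) (a b : arrow Q) (g h : G).
Implicit Types P : set alg.

Lemma lspan0 P : lspan P 0.
Proof. by exists [::]; rewrite big_nil. Qed.

Lemma lspanD P x y : lspan P x -> lspan P y -> lspan P (x + y).
Proof.
move=> [r [rP ->]] [s [sP ->]]; exists (r ++ s); rewrite big_cat; split=> // c.
by rewrite mem_cat => /orP[/rP|/sP].
Qed.

Lemma lspanZ P c x : lspan P x -> lspan P (c *: x).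
Proof.
move=> [r [rP ->]]; exists [seq (c * d.1, d.2) | d <- r]; split.
  by move=> _ /mapP[d /rP dP ->].
by rewrite big_map scaler_sumr; apply: eq_bigr => d _; rewrite scalerA.
Qed.

Lemma lspan_sum P I (r : seq I) (R : pred I) (F : I -> alg) :
  (forall t, R t -> lspan P (F t)) -> lspan P (\sum_(t <- r | R t) F t).
Proof. by move=> hF; apply: big_ind hF => //; [exact: lspan0|exact: lspanD]. Qed.

Lemma lspan_mem P x : P x -> lspan P x.
Proof.
move=> Px; exists [:: (1, x)]; rewrite big_seq1 scale1r; split=> // c.
by rewrite inE => /eqP->.
Qed.

Definition cyc0_mod k x :=
  exists2 y, lspan (@rotation_diffs K G n Q) y & deep k (x - y).

Lemma cyc0_modD k x y : cyc0_mod k x -> cyc0_mod k y -> cyc0_mod k (x + y).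
Proof.
move=> [u ru xu] [v rv yv]; exists (u + v); first exact: lspanD.
by rewrite opprD addrACA; exact: deepD.
Qed.

Lemma cyc0_modZ k c x : cyc0_mod k x -> cyc0_mod k (c *: x).
Proof.
move=> [u ru xu]; exists (c *: u); first exact: lspanZ.
by rewrite -scalerBr; exact: deepZ.
Qed.

Lemma cyc0_mod_deep k x : deep k x -> cyc0_mod k x.
Proof. by exists 0; [exact: lspan0|rewrite subr0]. Qed.

(** Cyclic equivalence to 0, with the filtration by length in place of the
    powers of the maximal ideal. *)
Definition cyc0 x := forall k, cyc0_mod k x.

Lemma cyc0D x y : cyc0 x -> cyc0 y -> cyc0 (x + y).
Proof. by move=> cx cy k; exact: cyc0_modD. Qed.
Lemma cyc0Z c x : cyc0 x -> cyc0 (c *: x).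
Proof. by move=> cx k; exact: cyc0_modZ. Qed.
Lemma cyc0_zero : cyc0 0.
Proof. by move=> k; exact: cyc0_mod_deep. Qed.
Lemma cyc0_sum I (r : seq I) (R : pred I) (F : I -> alg) :
  (forall t, R t -> cyc0 (F t)) -> cyc0 (\sum_(t <- r | R t) F t).
Proof. by move=> hF; apply: big_ind hF => //; [exact: cyc0_zero|exact: cyc0D]. Qed.

Lemma cyc0_lim x :
  (forall k, exists2 y, cyc0 y & deep k (x - y)) -> cyc0 x.
Proof.
move=> lx k; have [y cy xy] := lx k.
by rewrite -(subrK y x); apply: cyc0_modD => //; exact: cyc0_mod_deep.
Qed.

Lemma cyc0_equiv x y : cyc0 (x - y) -> cyc_equiv x y.
Proof.
by move=> cxy k; have [z rz dz] := cxy k; exists z => //; exact: maxideal_pow_deep.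
Qed.

Local Notation adj := (fun b c : arrow Q => tgt b == src c).

Lemma composable_path a s : composable (tgt a) s = path.path adj a s.
Proof. by elim: s a => //= b s IH a; rewrite eq_sym IH. Qed.

Lemma word_elt_rot k s : cycle adj s ->
  lspan (@rotation_diffs K G n Q) (word_elt K s - word_elt K (rot k s)).
Proof.
elim: k => [|k IH] cs; first by rewrite rot0 subrr; exact: lspan0.
case: (ltnP k (size s)) => ks; last first.
  by rewrite rot_oversize ?subrr; [exact: lspan0|exact: leqW].
have -> : rot k.+1 s = rot 1 (rot k s) by rewrite rotS.
rewrite -(subrK (word_elt K (rot k s)) (word_elt K s)) -addrA.
apply: lspanD; first exact: IH.
have: cycle adj (rot k s) by rewrite rot_cycle.
case: (rot k s) => [|a t] ct; first by rewrite subrr; exact: lspan0.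
by apply: lspan_mem; exists a, t; split; rewrite // rot1_cons.
Qed.

Lemma arrow_pelt a p :
  tgt a = pstart p -> arrow_elt K a * pelt K p = pelt K (pcons a p).
Proof.
move=> ap; apply: series_eq => [i|b].
  rewrite c0M c0_arrow mul0r /c0 /=.
  by case: (pnil Q i =P _) => // /(congr1 (@plen _ _ _)); rewrite plen_pcons.
rewrite ldivM c0_arrow scale0r add0r ldiv_arrow -cpscaleAl.
case: (eqVneq b a) => [->|ba].
  rewrite scale1r ap (homog_vertexl (homog_pelt K p)).
  apply: cpalgP => q /=; case: (tgt a =P pstart q) => [aq|naq]; last first.
    by case: (q =P p) naq => // ->; rewrite ap.
  congr (_ %:R); congr nat_of_bool; apply/eqP/eqP => [-> //|e].
  apply: qpathP; first by rewrite -aq.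
  by have := congr1 (@parrows _ _ _) e; rewrite !parrows_pcons // => -[].
rewrite scale0r; apply: cpalgP => q /=; case: (tgt b =P pstart q) => // bq.
case: (pcons b q =P _) => // /(congr1 (@parrows _ _ _)).
by rewrite !parrows_pcons // => -[/eqP]; rewrite (negPf ba).
Qed.

Lemma pelt_word p : vertex K Q (pstart p) * word_elt K (parrows p) = pelt K p.
Proof.
elim/qpath_ind: p => [i|a p ap IH]; first by rewrite [word_elt _ _]big_nil mulr1.
rewrite parrows_pcons // pstart_pcons // [word_elt _ _]big_cons mulrA.
rewrite (homog_vertexl (homog_arrow K a)).
by rewrite -(homog_vertexr (homog_arrow K a)) -mulrA ap IH arrow_pelt.
Qed.

Lemma pelt_word_neq0 p : parrows p != [::] -> pelt K p = word_elt K (parrows p).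
Proof.
elim/qpath_ind: p => [i //|a p ap _] _; rewrite -pelt_word.
rewrite parrows_pcons // pstart_pcons // [word_elt _ _]big_cons mulrA.
by rewrite (homog_vertexl (homog_arrow K a)).
Qed.

Lemma pelt_nil p : parrows p = [::] -> pelt K p = vertex K Q (pstart p).
Proof. by move=> p0; congr pelt; apply: qpathP. Qed.

Lemma pelt_comm p q : pend p = pstart q -> pend q = pstart p ->
  lspan (@rotation_diffs K G n Q) (pelt K p * pelt K q - pelt K q * pelt K p).
Proof.
move=> pq qp.
(* A trivial path is absorbed by the cycle on either side. *)
case: (eqVneq (parrows p) [::]) => [p0|p1].
  have pp : pend p = pstart p by rewrite /pend p0.
  rewrite (pelt_nil p0) -{2}qp (homog_vertexr (homog_pelt K q)) -pp pq.
  by rewrite (homog_vertexl (homog_pelt K q)) subrr; exact: lspan0.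
case: (eqVneq (parrows q) [::]) => [q0|q1].
  have qq : pend q = pstart q by rewrite /pend q0.
  rewrite (pelt_nil q0) -{1}pq (homog_vertexr (homog_pelt K p)) -qq qp.
  by rewrite (homog_vertexl (homog_pelt K p)) subrr; exact: lspan0.
rewrite !pelt_word_neq0 // -![word_elt _ _ * _]big_cat.
rewrite -(rot_size_cat (parrows p)); apply: word_elt_rot.
have := composableP p; have := composableP q; move: pq qp p1 q1.
rewrite /pend /endpoint.
case: (parrows p) => // a s; case: (parrows q) => // b t /= pq qp _ _.
move=> /andP[/eqP bq cq] /andP[/eqP ap cp].
rewrite rcons_cat cat_path -composable_path cp /= rcons_path.
by rewrite -composable_path cq -last_map pq -bq eqxx -(last_map (@tgt _ _ Q)) qp ap eqxx.
Qed.

(** Modulo long paths both factors are finite sums of paths, and two paths that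
    close up to a cycle have products that are rotations of each other. *)
Lemma cyc0_comm i j g h u v :
  homog i j g u -> homog j i h v -> cyc0 (u * v - v * u).
Proof.
move=> hu hv k; move: u hu; apply: (homog_ind (k := k)).
- move=> u du; apply: cyc0_mod_deep; apply: deepB.
    by rewrite -(addn0 k); exact: deepM.
  by rewrite -(add0n k); exact: deepM.
- by move=> u w cu cw; rewrite mulrDl mulrDr opprD addrACA; exact: cyc0_modD.
- by move=> c u cu; rewrite -cpscaleAl -cpscaleAr -scalerBr; exact: cyc0_modZ.
move=> p pi pj _; move: v hv; apply: (homog_ind (k := k)).
- move=> v dv; apply: cyc0_mod_deep; apply: deepB.
    by rewrite -(add0n k); exact: deepM.
  by rewrite -(addn0 k); exact: deepM.
- by move=> v w cv cw; rewrite mulrDl mulrDr opprD addrACA; exact: cyc0_modD.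
- by move=> c v cv; rewrite -cpscaleAl -cpscaleAr -scalerBr; exact: cyc0_modZ.
move=> q qj qi _; exists (pelt K p * pelt K q - pelt K q * pelt K p).
  by apply: pelt_comm; rewrite ?pi ?pj ?qi ?qj.
by rewrite subrr.
Qed.

End Cyclic.

(** * Substitution of series for arrows *)

Section Substitution.
Variables (K : fieldType) (G : groupType) (n : nat) (Q : wquiver G n).
Local Notation alg := (cpalg K Q).
Implicit Types (x y z : alg) (i j : 'I_n) (a b : arrow Q) (g h : G).
Implicit Types F : arrow Q -> alg.

Definition subst_step F (u : alg -> alg) x : alg :=
  cpart x + \sum_a F a * u (ldiv a x).

(** The continuous algebra endomorphism that sends [a] to [F a], when each [F a]
    has order at least 1 and the ends of [a]. From the seed [id], the iterates replace the first
    letters only, and keep the rest of each word. *)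
Definition subst F : alg -> alg := fixlim (subst_step F) id.

Lemma subst_iter0 F k : iter k (subst_step F) id 0 = 0.
Proof.
elim: k => // k IH; rewrite iterS /subst_step linear0 add0r.
by rewrite big1 // => b _; rewrite linear0 IH mulr0.
Qed.

Lemma subst_step_contr F : (forall a, deep 1 (F a)) ->
  forall k u v, (forall x, deep k (u x - v x)) ->
  forall x, deep k.+1 (subst_step F u x - subst_step F v x).
Proof.
move=> F1 k u v uv x; rewrite /subst_step opprD addrACA subrr add0r -sumrB.
by apply: deep_sum => a _; rewrite -mulrBr -add1n; exact: deepM.
Qed.

Section Morphism.
Variable F : arrow Q -> alg.
Hypothesis F1 : forall a, deep 1 (F a).

Lemma substE x : subst F x = cpart x + \sum_a F a * subst F (ldiv a x).
Proof. exact: (fixlimE (subst_step_contr F1)). Qed.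

Lemma deep_subst_iter k x : deep k (subst F x - iter k (subst_step F) id x).
Proof. exact: (deep_fixlim (subst_step_contr F1)). Qed.

Lemma subst_is_linear : linear (subst F).
Proof.
move=> c x y; apply: deep_eq => k; elim: k x y => // k IH x y.
rewrite !substE linearP.
rewrite (_ : _ - _ = \sum_a F a * (subst F (ldiv a (c *: x + y)) -
    (c *: subst F (ldiv a x) + subst F (ldiv a y)))).
  apply: deep_sum => a _; rewrite -add1n; apply: deepM => //.
  by rewrite linearP; exact: IH.
under [RHS]eq_bigr => a _ do rewrite mulrBr mulrDr -cpscaleAr.
rewrite sumrB big_split /= -scaler_sumr scalerDr.
by rewrite [X in _ - X]addrACA opprD addrACA subrr add0r.
Qed.
#[local] HB.instance Definition _ :=
  GRing.isLinear.Build K alg alg *:%R (subst F) subst_is_linear.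

Lemma substD x y : subst F (x + y) = subst F x + subst F y.
Proof. exact: linearD. Qed.
Lemma substB x y : subst F (x - y) = subst F x - subst F y.
Proof. exact: linearB. Qed.
Lemma substZ c x : subst F (c *: x) = c *: subst F x.
Proof. exact: linearZ. Qed.
Lemma subst_sum I (r : seq I) (P : pred I) (X : I -> alg) :
  subst F (\sum_(t <- r | P t) X t) = \sum_(t <- r | P t) subst F (X t).
Proof. exact: linear_sum. Qed.

Lemma subst_vertex i : subst F (vertex K Q i) = vertex K Q i.
Proof.
rewrite substE cpart_vertex big1 ?addr0 // => a _.
by rewrite ldiv_vertex linear0 mulr0.
Qed.

Lemma subst_one : subst F 1 = 1.
Proof.
rewrite substE cpart_one big1 ?addr0 // => a _.
by rewrite ldiv_one linear0 mulr0.
Qed.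

Hypothesis Fh : forall a, homog (src a) (tgt a) (wt a) (F a).

Lemma cpart_src a x : cpart x * F a = c0 (src a) x *: F a.
Proof.
rewrite /cpart mulr_suml (bigD1 (src a)) //= -cpscaleAl (homog_vertexl (@Fh a)).
rewrite big1 ?addr0 // => i ia.
rewrite -cpscaleAl (_ : _ * _ = 0) ?scaler0 // -(homog_vertexl (@Fh a)) mulrA.
rewrite (_ : vertex K Q i * _ = 0) ?mul0r //.
apply: series_eq => [j|b].
  rewrite c0M !c0_vertex /c0 scoef0.
  by case: (eqVneq j i) => [->|_]; rewrite ?mul0r // (negPf ia) mulr0.
by rewrite ldivM !ldiv_vertex mul0r scaler0 addr0 linear0.
Qed.

Lemma substM x y : subst F (x * y) = subst F x * subst F y.
Proof.
apply: deep_eq => k; elim: k x y => // k IH x y.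
have -> : subst F x * subst F y = cpart (x * y) +
    \sum_a F a * (c0 (src a) x *: subst F (ldiv a y) + subst F (ldiv a x) * subst F y).
  rewrite {1}substE mulrDl {1}substE mulrDr cpartM -addrA; congr (_ + _).
  rewrite mulr_suml mulr_sumr -big_split; apply: eq_bigr => a _ /=.
  rewrite mulrDr mulrA -cpscaleAr; congr (_ + _).
    by rewrite cpart_src -cpscaleAl.
  by rewrite mulrA.
rewrite substE opprD addrACA subrr add0r -sumrB; apply: deep_sum => a _.
rewrite -mulrBr -add1n; apply: deepM => //.
by rewrite ldivM linearP /= opprD addrACA subrr add0r.
Qed.

Lemma deep_subst k x : deep k x -> deep k (subst F x).
Proof.
elim: k x => // k IH x dx; rewrite substE (deep_cpart dx) add0r.
apply: deep_sum => a _; rewrite -add1n; apply: deepM => //.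
exact/IH/(deep_ldiv a dx).
Qed.

Lemma subst_arrow a : subst F (arrow_elt K a) = F a.
Proof.
rewrite substE cpart_arrow add0r (bigD1 a) //= ldiv_arrow eqxx scale1r.
rewrite subst_vertex (homog_vertexr (@Fh a)) big1 ?addr0 // => b ba.
by rewrite ldiv_arrow (negPf ba) scale0r linear0 mulr0.
Qed.

Lemma homog_subst i j g x : homog i j g x -> homog i j g (subst F x).
Proof.
move=> hx; apply: homog_lim => k.
exists (iter k (subst_step F) id x); last exact: deep_subst_iter.
elim: k i g x hx => // k IH i g x hx; rewrite iterS.
apply: homogD; first exact: homog_cpart.
apply: homog_sum => a _; case: (eqVneq (src a) i) => [ai|ai].
  rewrite -ai -[g](mulVKg (wt a)); apply: homogM (@Fh a) _.
  exact/IH/(homog_ldiv hx).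
by rewrite (ldiv_homog0 hx ai) subst_iter0 mulr0; exact: homog_zero.
Qed.

End Morphism.

(** Changing the image of one letter in order [k.+1] costs [k] more than the
    length of the letter, and all other letters still contribute their length. *)
Lemma deep_substB F F' k m x : (forall a, deep 1 (F a)) -> (forall a, deep 1 (F' a)) ->
  (forall a, deep k.+1 (F a - F' a)) -> deep m x ->
  deep (m + k) (subst F x - subst F' x).
Proof.
move=> F1 F1' FF dx.
suff: forall N, (N <= m + k)%N -> deep N (subst F x - subst F' x) by apply.
move=> N; elim: N m x dx => // N IH m x dx Nmk.
rewrite (substE F1) (substE F1') opprD addrACA subrr add0r -sumrB.
apply: deep_sum => a _; have da := deep_ldiv a dx.
rewrite -(subrK (F' a * subst F (ldiv a x)) (F a * _)) -addrA -mulrBl -mulrBr.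
apply: deepD.
  apply: (@deep_leq _ _ _ _ _ (k.+1 + m.-1)); first by case: m Nmk {dx da IH} => [|m] /= Nmk; lia.
  by apply: deepM => //; exact: deep_subst.
rewrite -add1n; apply: deepM => //; apply: IH da _.
by case: m Nmk {dx} => [|m] /= Nmk; lia.
Qed.

Section Unitriangular.
Variable F : arrow Q -> alg.
Hypothesis F2 : forall a, deep 2 (F a - arrow_elt K a).

Lemma unitri_deep1 a : deep 1 (F a).
Proof.
rewrite -(subrK (arrow_elt K a) (F a)); apply: deepD (deep_arrow K a).
by apply: deep_leq (F2 a).
Qed.

Let F1 := unitri_deep1.

Lemma subst_id x : subst (@arrow_elt K G n Q) x = x.
Proof.
have a1 := deep_arrow K (Q := Q).
apply: deep_eq => k; elim: k x => // k IH x; rewrite (substE a1).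
rewrite [X in _ - X]decomp opprD addrACA subrr add0r -sumrB.
by apply: deep_sum => a _; rewrite -mulrBr -add1n; exact: deepM.
Qed.

Lemma deep_subst_unitri k x : deep k x -> deep k.+1 (subst F x - x).
Proof.
move=> dx; rewrite -{2}(subst_id x) -addn1.
by apply: deep_substB => // a; exact: deep_arrow.
Qed.

(** Constant parts are fixed, so that the previous lemma applies from order 1
    on. *)
Lemma deep2_subst_unitri x : deep 2 (subst F x - x).
Proof.
have dc : deep 1 (x - cpart x).
  apply: deepS => // i; by rewrite /c0 scoefB -!/(c0 _ _) c0_cpart subrr.
have := deep_subst_unitri dc; rewrite (substB F1) opprB addrA addrAC.
rewrite (_ : subst F (cpart x) = cpart x) ?addrK ?subrK //; last first.
  rewrite (subst_sum F1); apply: eq_bigr => i _.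
  by rewrite (substZ F1) (subst_vertex F1).
by rewrite addrAC subrK.
Qed.

(** The equation [subst F x = y] reads [x = y - (subst F x - x)], whose right
    hand side is a contraction in [x]. *)
Lemma subst_bij : bijective (subst F).
Proof.
pose Psi y (u : unit -> alg) t := y - (subst F (u t) - u t).
have contr y k u v : (forall t, deep k (u t - v t)) ->
    forall t, deep k.+1 (Psi y u t - Psi y v t).
  move=> uv t; set A := subst F (u t) - u t; set B := subst F (v t) - v t.
  have -> : Psi y u t - Psi y v t = subst F (v t - u t) - (v t - u t).
    rewrite -[LHS]/(y - A - (y - B)) [- (y - B)]opprD addrACA subrr add0r opprK addrC substB //.
    by rewrite /A /B !opprB addrACA [RHS]addrACA; congr (_ + _); rewrite addrC.
  exact/deep_subst_unitri/deepBC.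
pose f y := fixlim (Psi y) (fun=> 0) tt.
have fK y : subst F (f y) = y.
  have e := fixlimE (contr y) (fun=> 0) tt; rewrite -/(f y) /Psi -/(f y) in e.
  by move/eqP: e; rewrite eq_sym subr_eq addrC subrK => /eqP.
have injF : injective (subst F).
  move=> x x' xx'; apply: deep_eq; elim=> // k /deep_subst_unitri.
  by rewrite substB // xx' subrr add0r => /deepN; rewrite opprK.
by exists f => // x; apply: injF; rewrite fK.
Qed.

End Unitriangular.
End Substitution.

(** * Elimination of the trivial directions from cyclic series *)

Section Reduction.
Variables (K : fieldType) (G : groupType) (n : nat) (Q : wquiver G n).
Local Notation alg := (cpalg K Q).
Implicit Types (x y z : alg) (i j : 'I_n) (a b : arrow Q) (g h : G).

Definition cyclic x := forall p, coef x p != 0 -> pend p = pstart p /\ pwt p = 1%g.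

Lemma cyclicD x y : cyclic x -> cyclic y -> cyclic (x + y).
Proof.
move=> cx cy p; rewrite scoefD; case: (eqVneq (coef x p) 0) => [->|/cx //].
by rewrite add0r => /cy.
Qed.

Lemma cyclicZ c x : cyclic x -> cyclic (c *: x).
Proof. by move=> cx p; rewrite scoefZ mulf_eq0 negb_or => /andP[_ /cx]. Qed.

Lemma cyclic_zero : cyclic 0.
Proof. by move=> p; rewrite scoef0 eqxx. Qed.

Lemma cyclic_sum I (r : seq I) (P : pred I) (F : I -> alg) :
  (forall t, P t -> cyclic (F t)) -> cyclic (\sum_(t <- r | P t) F t).
Proof. by move=> hF; apply: big_ind hF => //; [exact: cyclic_zero|exact: cyclicD]. Qed.

Lemma homog_cyclic i x : homog i i 1%g x -> cyclic x.
Proof. by move=> hx p /hx[-> -> ->]. Qed.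

Lemma sum_vertexM x : \sum_i vertex K Q i * x = x.
Proof. by rewrite -mulr_suml sum_vertex mul1r. Qed.

Lemma cyclic_subst F x : (forall a, deep 1 (F a)) ->
  (forall a, homog (src a) (tgt a) (wt a) (F a)) -> cyclic x -> cyclic (subst F x).
Proof.
move=> F1 Fh cx; rewrite -(sum_vertexM x) (subst_sum F1).
apply: cyclic_sum => i _; apply: (@homog_cyclic i).
exact/(homog_subst F1 Fh)/vertex_homog.
Qed.

(** In the application [w a] is the component of the arrow [a] in the reduced
    part, and the [dd b] span the trivial part. *)
Variables (w dd : arrow Q -> alg) (c : arrow Q -> arrow Q -> K).
Hypothesis w1 : forall a, deep 1 (w a).
Hypothesis wh : forall a, homog (src a) (tgt a) (wt a) (w a).
Hypothesis ddh : forall b, homog (tgt b) (src b) (wt b)^-1%g (dd b).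
Hypothesis ch : forall a b, c a b != 0 ->
  [/\ src b = tgt a, tgt b = src a & wt b = (wt a)^-1%g].
Hypothesis split : forall a, arrow_elt K a = w a + \sum_b c a b *: dd b.

(** A cyclic derivative: expand each letter [a] of a cyclic word as in [split],
    and let the first trivial letter [dd b] be followed by what comes after it,
    then by the word in reduced letters that precedes it and is kept in [y].
    The fuel [k] bounds the number of letters that are expanded. *)
Fixpoint cder_iter k b x y : alg :=
  if k is k'.+1 then
    \sum_a (c a b *: (ldiv a x * y) + cder_iter k' b (ldiv a x) (y * w a))
  else 0.

Lemma cder_iterE k b x y : cder_iter k.+1 b x y =
  \sum_a (c a b *: (ldiv a x * y) + cder_iter k b (ldiv a x) (y * w a)).
Proof. by []. Qed.

Definition cder b x : alg :=
  \sum_i series_lim (fun k => cder_iter k b (vertex K Q i * x) (vertex K Q i)).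

Lemma cder_iterB k b x x' y :
  cder_iter k b (x - x') y = cder_iter k b x y - cder_iter k b x' y.
Proof.
elim: k x x' y => [|k IH] x x' y; first by rewrite subr0.
rewrite !cder_iterE -sumrB; apply: eq_bigr => a _.
by rewrite linearB /= IH mulrBl scalerBr addrACA opprD.
Qed.

Lemma cder_iter0 k b y : cder_iter k b 0 y = 0.
Proof. by rewrite -{1}(subrr 0) cder_iterB subrr. Qed.

Lemma deep_cder_iter k b m l x y :
  deep m x -> deep l y -> deep (m.-1 + l) (cder_iter k b x y).
Proof.
elim: k m l x y => [|k IH] m l x y dx dy //.
rewrite cder_iterE; apply: deep_sum => a _; have da := deep_ldiv a dx; apply: deepD.
  by apply/deepZ/deepM.
apply: (@deep_leq _ _ _ _ _ (m.-1.-1 + (l + 1))); first by lia.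
by apply: IH => //; exact: deepM.
Qed.

(** Every expanded letter is moved to [y] and raises its order by 1. *)
Lemma deep_cder_iterS k b l x y :
  deep l y -> deep (k + l) (cder_iter k.+1 b x y - cder_iter k b x y).
Proof.
elim: k l x y => [|k IH] l x y dy.
  rewrite subr0; apply: (@deep_cder_iter 1 b 0) => //.
rewrite !cder_iterE -sumrB.
apply: deep_sum => a _; rewrite opprD addrACA subrr add0r.
by rewrite addSnnS -addn1; apply/IH/deepM.
Qed.

Lemma deep_lim_cder k b i x :
  deep k (series_lim (fun k => cder_iter k b (vertex K Q i * x) (vertex K Q i)) -
    cder_iter k b (vertex K Q i * x) (vertex K Q i)).
Proof.
apply: (@deep_lim _ _ _ _ (fun k => cder_iter k b _ _)) => {}k.
by rewrite -[X in deep X](addn0 k); exact: deep_cder_iterS.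
Qed.

Lemma homog_cder_iter k b i j g h x y : (g * h = 1)%g ->
  homog i j g x -> homog j i h y ->
  homog (src b) (tgt b) (wt b) (cder_iter k b x y).
Proof.
elim: k i g h x y => [|k IH] i g h x y gh hx hy; first exact: homog_zero.
rewrite cder_iterE; apply: homog_sum => a _; case: (eqVneq (src a) i) => [ai|ai]; last first.
  rewrite (ldiv_homog0 hx ai) mul0r scaler0 add0r.
  by rewrite cder_iter0; exact: homog_zero.
have hax := homog_ldiv (a := a) hx; apply: homogD.
  case: (eqVneq (c a b) 0) => [->|/ch[-> -> ->]].
    by rewrite scale0r; exact: homog_zero.
  apply: homogZ; rewrite ai -(mulg1 (wt a)^-1%g) -gh mulgA.
  exact: homogM hax hy.
apply: (IH (tgt a) ((wt a)^-1 * g)%g (h * wt a)%g) => //.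
  by rewrite mulgA -[(_ * g * h)%g]mulgA gh mulg1 mulVg.
by apply: homogM hy _; rewrite -ai.
Qed.

(** With finite fuel the reduction is exact: the first [k] letters have been
    expanded and what follows them is still unreduced. *)
Lemma cyc0_cder_iter k i j g h x y : homog i j g x -> homog j i h y ->
  cyc0 (y * x - (\sum_b dd b * cder_iter k b x y
                 + y * iter k (subst_step w) id x)).
Proof.
elim: k i g h x y => [|k IH] i g h x y hx hy.
  by rewrite big1 => [|b _]; rewrite ?mulr0 // add0r subrr; exact: cyc0_zero.
have -> : y * x - (\sum_b dd b * cder_iter k.+1 b x y
      + y * iter k.+1 (subst_step w) id x) =
    \sum_a (\sum_b c a b *: (y * (dd b * ldiv a x) - dd b * ldiv a x * y) +
      (y * w a * ldiv a x - (\sum_b dd b * cder_iter k b (ldiv a x) (y * w a)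
         + y * w a * iter k (subst_step w) id (ldiv a x)))).
  have e1 : y * x = y * cpart x + \sum_a (y * w a * ldiv a x +
      \sum_b c a b *: (y * (dd b * ldiv a x))).
    rewrite {1}[x]decomp mulrDr mulr_sumr; congr (_ + _); apply: eq_bigr => a _.
    rewrite split mulrDl mulrDr mulrA; congr (_ + _).
    rewrite mulr_suml mulr_sumr; apply: eq_bigr => b _.
    by rewrite -cpscaleAl -cpscaleAr.
  have e2 : \sum_b dd b * cder_iter k.+1 b x y =
      \sum_a (\sum_b c a b *: (dd b * ldiv a x * y) +
              \sum_b dd b * cder_iter k b (ldiv a x) (y * w a)).
    under eq_bigr => b _ do rewrite cder_iterE mulr_sumr.
    rewrite exchange_big; apply: eq_bigr => a _ /=.
    rewrite -big_split; apply: eq_bigr => b _ /=.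
    by rewrite mulrDr -cpscaleAr mulrA.
  have e3 : y * iter k.+1 (subst_step w) id x = y * cpart x +
      \sum_a y * w a * iter k (subst_step w) id (ldiv a x).
    rewrite iterS mulrDr mulr_sumr; congr (_ + _).
    by apply: eq_bigr => a _; rewrite mulrA.
  rewrite e1 e2 e3 [X in _ - X]addrCA opprD addrACA subrr add0r -big_split -sumrB.
  apply: eq_bigr => a _ /=.
  under [\sum_b c a b *: (_ - _)]eq_bigr => b _ do rewrite scalerBr.
  by rewrite sumrB -[_ + _ + _ * iter _ _ _ _]addrA opprD (addrC (_ * _)) addrACA.
apply: cyc0_sum => a _; case: (eqVneq (src a) i) => [ai|ai]; last first.
  rewrite (ldiv_homog0 hx ai) subst_iter0 !big1 => [|b _|b _].
  - by rewrite !mulr0 !add0r oppr0; exact: cyc0_zero.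
  - by rewrite cder_iter0 mulr0.
  - by rewrite !(mulr0, mul0r) subrr scaler0.
have hax := homog_ldiv (a := a) hx; apply: cyc0D.
  apply: cyc0_sum => b _.
  case: (eqVneq (c a b) 0) => [->|/ch[ba ab wab]].
    by rewrite scale0r; exact: cyc0_zero.
  apply: cyc0Z; apply: (cyc0_comm hy (h := (wt b)^-1 * ((wt a)^-1 * g))%g).
  by apply: homogM hax; rewrite -ai -ba -ab.
by apply: (IH (tgt a) _ _ _ _ hax (homogM hy _)); rewrite -ai.
Qed.

Lemma deep_cder m b x : deep m x -> deep m.-1 (cder b x).
Proof.
move=> dx; apply: deep_sum => i _.
rewrite -(subrK (cder_iter m.-1 b (vertex K Q i * x) (vertex K Q i)) (series_lim _)).
apply: deepD; first exact: deep_lim_cder.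
rewrite -[m.-1]addn0; apply: deep_cder_iter => //.
by rewrite -[m]add0n; exact: deepM.
Qed.

Lemma cderB b x x' : cder b (x - x') = cder b x - cder b x'.
Proof.
rewrite /cder -sumrB; apply: eq_bigr => i _.
rewrite mulrBr; apply: cpalgP => p.
exact: (congr1 (fun z => coef z p) (cder_iterB (plen p).+1 _ _ _ _)).
Qed.

Lemma homog_cder b x : cyclic x -> homog (src b) (tgt b) (wt b) (cder b x).
Proof.
move=> cx; apply: homog_sum => i _; apply: homog_lim => k.
exists (cder_iter k b (vertex K Q i * x) (vertex K Q i)); last exact: deep_lim_cder.
apply: (@homog_cder_iter _ _ i i 1%g 1%g); rewrite ?mulg1 //.
  exact: vertex_homog.
exact: homog_vertex.
Qed.

Lemma cyc0_cder x : cyclic x ->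
  cyc0 (x - (\sum_b dd b * cder b x + subst w x)).
Proof.
move=> cx.
pose L i b := series_lim (fun k => cder_iter k b (vertex K Q i * x) (vertex K Q i)).
have -> : x - (\sum_b dd b * cder b x + subst w x) =
    \sum_i (vertex K Q i * x -
      (\sum_b dd b * L i b + subst w (vertex K Q i * x))).
  rewrite sumrB sum_vertexM big_split /= -(subst_sum w1) sum_vertexM.
  congr (_ - (_ + _)); rewrite exchange_big; apply: eq_bigr => b _.
  by rewrite mulr_sumr.
apply: cyc0_sum => i _; apply: cyc0_lim => k.
have hx := vertex_homog (i := i) cx; have hi := @homog_vertex K G n Q i.
set e := vertex K Q i in hx hi *.
exists (e * (e * x) - (\sum_b dd b * cder_iter k b (e * x) e
                 + e * iter k (subst_step w) id (e * x))).
  exact: cyc0_cder_iter hx hi.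
rewrite (homog_vertexl hx) -(homog_vertexl (homog_subst w1 wh hx)).
set A := (X in deep k (_ - X - _)); set B := (X in deep k (_ - (_ - X))).
rewrite (_ : _ - _ = B - A); last first.
  by rewrite [- (_ - B)]opprB addrC addrA subrK.
rewrite opprD addrACA -sumrB -mulrBr; apply: deepD.
  apply: deep_sum => b _; rewrite -mulrBr -[k]add0n; apply: deepM => //.
  exact/deepBC/deep_lim_cder.
by rewrite -[k]add0n; apply: deepM => //; exact/deepBC/deep_subst_iter.
Qed.

End Reduction.

(** * The automorphism *)

Section Splitting.
Variables (K : fieldType) (G : groupType) (n : nat) (Q : wquiver G n).
Local Notation alg := (cpalg K Q).
Implicit Types (x y z : alg) (i j : 'I_n) (a b : arrow Q) (g h : G).
Variable S : alg.
Hypothesis potS : potential S.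

Lemma potential_cyclic : cyclic S.
Proof. by move=> p /potS /and3P[_ /eqP-> /eqP->]. Qed.

Lemma coef2_neq0 a b : coef2 S a b != 0 ->
  [/\ src b = tgt a, tgt b = src a & wt b = (wt a)^-1%g].
Proof.
rewrite /coef2; case: insubP => [p _ vp /=|_]; last by rewrite eqxx.
have := composableP p => /[swap] /potS /and3P[_].
rewrite /pend /pwt /endpoint /pstart /parrows vp /= big_cons big_seq1.
move=> /eqP ba /eqP ab /andP[_ /andP[/eqP-> _]]; split=> //.
by rewrite -[RHS]mulg1 -ab mulKg.
Qed.

Lemma sym_coef2C a b : sym_coef2 S a b = sym_coef2 S b a.
Proof. exact: addrC. Qed.

Lemma sym_coef2_neq0 a b : sym_coef2 S a b != 0 ->
  [/\ src b = tgt a, tgt b = src a & wt b = (wt a)^-1%g].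
Proof.
rewrite /sym_coef2; case: (eqVneq (coef2 S a b) 0) => [->|/coef2_neq0 //].
by rewrite add0r => /coef2_neq0[-> -> ->]; rewrite invgK.
Qed.

Definition quad : alg :=
  \sum_a \sum_b coef2 S a b *: (arrow_elt K a * arrow_elt K b).

Lemma deep_quad : deep 2 quad.
Proof.
apply: deep_sum => a _; apply: deep_sum => b _.
by apply: deepZ; apply: (@deepM _ _ _ _ 1 1); exact: deep_arrow.
Qed.

Lemma cyclic_coef2 (x y : arrow Q -> alg) :
  (forall a, homog (src a) (tgt a) (wt a) (x a)) ->
  (forall a, homog (src a) (tgt a) (wt a) (y a)) ->
  cyclic (\sum_a \sum_b coef2 S a b *: (x a * y b)).
Proof.
move=> hx hy; apply: cyclic_sum => a _; apply: cyclic_sum => b _.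
case: (eqVneq (coef2 S a b) 0) => [->|/coef2_neq0[ba ab wab]].
  by rewrite scale0r; exact: cyclic_zero.
apply: cyclicZ; apply: (@homog_cyclic _ _ _ _ (src a)).
by rewrite -(mulgV (wt a)) -wab -{2}ab; apply: homogM (hx a) _; rewrite -ba.
Qed.

Lemma coef_pcons x a p : tgt a = pstart p -> coef x (pcons a p) = coef (ldiv a x) p.
Proof. by move=> ap /=; rewrite ap eqxx. Qed.

Lemma coef_quad a b i : tgt a = src b -> tgt b = i ->
  coef quad (pcons a (pcons b (pnil Q i))) = coef2 S a b.
Proof.
move=> ab bi; have bp : tgt b = pstart (pnil Q i) by [].
have ap : tgt a = pstart (pcons b (pnil Q i)) by rewrite pstart_pcons.
rewrite !coef_pcons // -/(c0 i _) /quad linear_sum /= linear_sum /= c0_sum.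
rewrite (bigD1 a) //= [X in _ + X]big1 ?addr0 => [|a' a'a].
  rewrite linear_sum /= linear_sum /= c0_sum (bigD1 b) //= big1 ?addr0 => [|b' b'b].
    rewrite !linearZ /= ldiv_arrowM eqxx scale1r ldivM ldiv_vertex mul0r addr0.
    by rewrite ldiv_arrow c0_vertex ab !eqxx !scale1r c0Z c0_vertex bi eqxx mulr1.
  rewrite !linearZ /= ldiv_arrowM eqxx scale1r ldivM ldiv_vertex mul0r addr0.
  by rewrite ldiv_arrow eq_sym (negPf b'b) scale0r scaler0 c0Z mulr0.
rewrite linear_sum /= big1 ?linear0 // => b' _.
by rewrite linearZ /= ldiv_arrowM eq_sym (negPf a'a) scale0r scaler0.
Qed.

(** In length 1 there is nothing to compare, as a cyclic arrow would be a
    loop. *)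
Lemma deep_rest : deep 3 (S - quad).
Proof.
move=> p p3; rewrite scoefB; apply/eqP; rewrite subr_eq0; apply/eqP.
elim/qpath_ind: p p3 => [i _|a p ap _].
  rewrite deep_quad //; apply/eqP; apply: contraT => /potS /and3P[]//.
rewrite plen_pcons //; elim/qpath_ind: p ap => [i ai _|b p bp _].
  rewrite deep_quad ?plen_pcons //; apply/eqP; apply: contraT => /potS /and3P[_].
  rewrite pend_pcons // pstart_pcons // => /eqP e _.
  by have := noloop a; rewrite ai -e eqxx.
rewrite plen_pcons // pstart_pcons //; elim/qpath_ind: p bp => [i bi|]; last first.
  by move=> d p dp _ _ _; rewrite plen_pcons.
move=> ab _; rewrite coef_quad // /coef2.
have bp : tgt b = pstart (pnil Q i) by [].
have ap : tgt a = pstart (pcons b (pnil Q i)) by rewrite pstart_pcons.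
have vp : pval (pcons a (pcons b (pnil Q i))) = (src a, [:: a; b]).
  by rewrite val_pcons // parrows_pcons.
by rewrite -vp valK.
Qed.

(** Restriction to the terms that a unitriangular graded automorphism may add
    to the arrow [b]. With it the equation for the corrections makes sense, and
    is a contraction, on arbitrary families of series, while every solution is
    admissible. *)
Definition admissible b x : alg := Series (fun p =>
  if [&& (2 <= plen p)%N, pstart p == src b, pend p == tgt b & pwt p == wt b]
  then coef x p else 0).

Lemma deep_admissible b x : deep 2 (admissible b x).
Proof. by move=> p p2 /=; rewrite leqNgt p2. Qed.

Lemma homog_admissible b x : homog (src b) (tgt b) (wt b) (admissible b x).
Proof.
by move=> p /=; case: ifP => [/and4P[_ /eqP-> /eqP-> /eqP->] //|_]; rewrite eqxx.
Qed.

Lemma deep_admissibleB k b x y :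
  deep k (x - y) -> deep k (admissible b x - admissible b y).
Proof.
by move=> dxy p /dxy /=; case: ifP => // _ _; rewrite subr0.
Qed.

Lemma admissible_id b x :
  deep 2 x -> homog (src b) (tgt b) (wt b) x -> admissible b x = x.
Proof.
move=> dx hx; apply: cpalgP => p /=.
case: (eqVneq (coef x p) 0) => [->|xp]; first by case: ifP.
have [-> -> ->] := hx p xp; rewrite !eqxx andbT.
by case: leqP => // /dx xp0; rewrite xp0 eqxx in xp.
Qed.

Variables (w dd : arrow Q -> alg) (c : arrow Q -> arrow Q -> K).
Hypothesis w1 : forall a, deep 1 (w a).
Hypothesis wh : forall a, homog (src a) (tgt a) (wt a) (w a).
Hypothesis ddE : forall b, dd b = \sum_a sym_coef2 S a b *: arrow_elt K a.
Hypothesis ch : forall a b, c a b != 0 ->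
  [/\ src b = tgt a, tgt b = src a & wt b = (wt a)^-1%g].
Hypothesis split : forall a, arrow_elt K a = w a + \sum_b c a b *: dd b.

Lemma homog_dd b : homog (tgt b) (src b) (wt b)^-1%g (dd b).
Proof.
rewrite ddE; apply: homog_sum => a _.
case: (eqVneq (sym_coef2 S a b) 0) => [->|/sym_coef2_neq0[-> -> ->]].
  by rewrite scale0r; exact: homog_zero.
by rewrite invgK; exact/homogZ/homog_arrow.
Qed.

Let F (f : arrow Q -> alg) a := arrow_elt K a + admissible a (f a).

(** What remains of [subst (F f) S] after removing its quadratic part and the
    terms that are linear in [f]. *)
Let remainder f : alg :=
  \sum_a \sum_b coef2 S a b *: (admissible a (f a) * admissible b (f b)) +
  subst (F f) (S - quad).

Let Psi (f : arrow Q -> alg) b := - cder w c b (remainder f).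

Lemma deep_F f a : deep 2 (F f a - arrow_elt K a).
Proof. by rewrite addrC addKr; exact: deep_admissible. Qed.

Lemma homog_F f a : homog (src a) (tgt a) (wt a) (F f a).
Proof. by apply: homogD; [exact: homog_arrow|exact: homog_admissible]. Qed.

Let F1 f := unitri_deep1 (deep_F f).

Lemma deep_remainder f : deep 3 (remainder f).
Proof.
apply: deepD; last by apply: deep_subst; [exact: F1|exact: deep_rest].
apply: deep_sum => a _; apply: deep_sum => b _; apply: deepZ.
apply: (@deep_leq _ _ _ _ 3 (2 + 2)) => //.
by apply: deepM; exact: deep_admissible.
Qed.

Lemma cyclic_remainder f : cyclic (remainder f).
Proof.
apply: cyclicD; first by apply: cyclic_coef2 => a; exact: homog_admissible.
apply: cyclic_subst; [exact: F1|exact: homog_F|].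
rewrite -scaleN1r; apply: cyclicD potential_cyclic _; apply: cyclicZ.
by apply: cyclic_coef2 => a; exact: homog_arrow.
Qed.

(** Corrections occur in the remainder either next to another correction, of
    order at least 2, or inside words of length at least 3. *)
Lemma deep_remainderB k f f' : (forall a, deep k (f a - f' a)) ->
  deep k.+2 (remainder f - remainder f').
Proof.
move=> ff; rewrite opprD addrACA -sumrB.
have dff a := deep_admissibleB a (ff a); apply: deepD.
  apply: deep_sum => a _; rewrite -sumrB; apply: deep_sum => b _.
  rewrite -scalerBr; apply: deepZ.
  rewrite -(subrK (admissible a (f' a) * admissible b (f b)) (_ * admissible b (f b))).
  rewrite -addrA -mulrBl -mulrBr; apply: deepD.
    by rewrite -addn2; apply: deepM => //; exact: deep_admissible.
  by rewrite -add2n; apply: deepM => //; exact: deep_admissible.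
(* Admissible corrections agree up to order 2 at least, whatever [k] is. *)
apply: (@deep_leq _ _ _ _ _ (3 + (maxn k 2).-1)); first lia.
apply: deep_substB; [exact: F1|exact: F1| |exact: deep_rest] => a.
rewrite prednK; last by lia.
rewrite opprD addrACA subrr add0r /maxn; case: ifP => // _.
by apply: deepB; exact: deep_admissible.
Qed.

Lemma Psi_contr k f f' : (forall a, deep k (f a - f' a)) ->
  forall b, deep k.+1 (Psi f b - Psi f' b).
Proof.
move=> ff b; rewrite -opprD -cderB; apply: deepN.
exact: (deep_cder _ _ _ (deep_remainderB ff)).
Qed.

(** The part of [subst F S] that is linear in [f] pairs each [f b] with the
    cyclic derivative of the quadratic part. *)
Lemma cyc0_linear_part (f : arrow Q -> alg) :
  (forall a, homog (src a) (tgt a) (wt a) (f a)) ->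
  cyc0 (\sum_a \sum_b coef2 S a b *: (f a * arrow_elt K b + arrow_elt K a * f b)
        - \sum_b dd b * f b).
Proof.
move=> fh.
have -> : \sum_b dd b * f b = \sum_a \sum_b
    coef2 S a b *: (arrow_elt K b * f a + arrow_elt K a * f b).
  under eq_bigr => b _ do rewrite ddE mulr_suml.
  under [RHS]eq_bigr => a _ do under eq_bigr => b _ do rewrite scalerDr.
  under [RHS]eq_bigr => a _ do rewrite big_split.
  rewrite big_split /= [X in _ + X]exchange_big -big_split; apply: eq_bigr => b _ /=.
  rewrite -big_split; apply: eq_bigr => a _ /=.
  by rewrite -cpscaleAl -scalerDl addrC.
rewrite -sumrB; apply: cyc0_sum => a _; rewrite -sumrB; apply: cyc0_sum => b _.
rewrite -scalerBr opprD addrACA subrr addr0.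
case: (eqVneq (coef2 S a b) 0) => [->|/coef2_neq0[ba ab _]].
  by rewrite scale0r; exact: cyc0_zero.
by apply: cyc0Z; apply: (cyc0_comm (fh a)); rewrite -ba -ab; exact: homog_arrow.
Qed.

(** The corrections [f b] are chosen to cancel the cyclic derivatives of the
    remainder that they create themselves. *)
Lemma splitting : exists (phi : arrow Q -> alg) (X : alg),
  [/\ forall a, deep 2 (phi a - arrow_elt K a),
      forall a, homog (src a) (tgt a) (wt a) (phi a),
      cyclic X, deep 3 X & cyc0 (subst phi S - (quad + subst w X))].
Proof.
pose f := fixlim Psi (fun=> 0).
have fE b : f b = - cder w c b (remainder f) by exact: (fixlimE Psi_contr).
have fh b : homog (src b) (tgt b) (wt b) (f b).
  rewrite fE; apply: homogN; apply: homog_cder => //; exact: cyclic_remainder.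
have f2 b : deep 2 (f b).
  by rewrite fE; apply: deepN; apply: (deep_cder _ _ _ (deep_remainder f)).
have fa b : admissible b (f b) = f b by exact: admissible_id.
exists (F f), (remainder f); split.
- exact: deep_F.
- exact: homog_F.
- exact: cyclic_remainder.
- exact: deep_remainder.
pose L := \sum_a \sum_b coef2 S a b *: (f a * arrow_elt K b + arrow_elt K a * f b).
have eS : subst (F f) S = quad + L + remainder f.
  rewrite -{1}(subrK quad S) (substD (F1 f)) addrC addrA; congr (_ + _).
  rewrite (subst_sum (F1 f)) -!big_split; apply: eq_bigr => a _ /=.
  rewrite (subst_sum (F1 f)) -!big_split; apply: eq_bigr => b _ /=.
  rewrite (substZ (F1 f)) (substM (F1 f) (@homog_F f)).
  rewrite !(subst_arrow (F1 f) (@homog_F f)) -!scalerDr /F !fa; congr (_ *: _).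
  by rewrite mulrDl !mulrDr -!addrA; congr (_ + _); rewrite addrCA !addrA.
have -> : subst (F f) S - (quad + subst w (remainder f)) =
    (L - \sum_b dd b * f b) +
    (remainder f - (\sum_b dd b * cder w c b (remainder f) + subst w (remainder f))).
  have -> : \sum_b dd b * cder w c b (remainder f) = - \sum_b dd b * f b.
    by rewrite -sumrN; apply: eq_bigr => b _; rewrite -mulrN [in RHS]fE opprK.
  rewrite eS -[quad + L + _]addrA opprD addrACA subrr add0r -addrA.
  by rewrite [- (- _ + _)]opprD opprK (addrCA (remainder f)) [RHS]addrA subrK.
apply: cyc0D; first exact: cyc0_linear_part.
apply: cyc0_cder => //; [exact: homog_dd|exact: cyclic_remainder].
Qed.

End Splitting.

(** * The arrow span and the tensor algebras inside the path algebra *)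

Section Tensor.
Variables (K : fieldType) (G : groupType) (n : nat) (Q : wquiver G n).
Local Notation alg := (cpalg K Q).
Local Notation A := (aspan K Q).
Implicit Types (x y z : alg) (i j : 'I_n) (a b : arrow Q) (g h : G).
Implicit Types (u v : A) (U : {vspace A}).

Lemma aspan_eltE v : aspan_elt v = \sum_a (v a : K) *: arrow_elt K a.
Proof. by []. Qed.

Fact aspan_elt_is_linear : linear (@aspan_elt K G n Q).
Proof.
move=> c u v; rewrite /aspan_elt scaler_sumr -big_split; apply: eq_bigr => a _ /=.
by rewrite !ffunE scalerDl scalerA.
Qed.
HB.instance Definition _ :=
  GRing.isLinear.Build K A alg *:%R (@aspan_elt K G n Q) aspan_elt_is_linear.

Lemma aspan_elt_delta a : aspan_elt (delta K a) = arrow_elt K a.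
Proof.
rewrite aspan_eltE (bigD1 a) //= ffunE eqxx scale1r big1 ?addr0 // => b ba.
by rewrite ffunE (negPf ba) scale0r.
Qed.

Lemma deep_aspan_elt v : deep 1 (aspan_elt v).
Proof. by apply: deep_sum => a _; apply/deepZ/deep_arrow. Qed.

Lemma span_delta (P : pred (arrow Q)) v :
  v \in <<[seq delta K a | a <- enum P]>>%VS ->
  aspan_elt v = \sum_(a in P) (v a : K) *: arrow_elt K a.
Proof.
move=> vP; rewrite [RHS]big_mkcond; apply: eq_bigr => a _.
case: ifPn => // aP; rewrite (_ : v a = 0) ?scale0r //.
rewrite (coord_span (X := in_tuple _) vP) sum_ffunE big1 // => k _.
rewrite ffunE; have /mapP[b bP ->] := mem_nth 0 (ltn_ord k).
rewrite ffunE; case: eqP => [ab|_]; last exact: mulr0.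
by rewrite ab -mem_enum bP in aP.
Qed.

Lemma homog_eAe i j g v : v \in eAe K Q i j g -> homog i j g (aspan_elt v).
Proof.
move=> /span_delta ->; apply: homog_sum => a /and3P[/eqP<- /eqP<- /eqP<-].
exact/homogZ/homog_arrow.
Qed.

Lemma delta_eAe a : delta K a \in eAe K Q (src a) (tgt a) (wt a).
Proof. by apply/memv_span/map_f; rewrite mem_enum inE !eqxx. Qed.

(** ** Homogeneous components *)

Lemma coef_hcomp d x p : coef (hcomp d x) p = if plen p == d then coef x p else 0.
Proof. by []. Qed.

Lemma hcompD d x y : hcomp d (x + y) = hcomp d x + hcomp d y.
Proof. by apply: cpalgP => p /=; case: ifP; rewrite ?addr0. Qed.
Lemma hcompZ d c x : hcomp d (c *: x) = c *: hcomp d x.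
Proof. by apply: cpalgP => p /=; case: ifP; rewrite ?mulr0. Qed.
Lemma hcomp_zero d : hcomp d (0 : alg) = 0.
Proof. by apply: cpalgP => p /=; case: ifP. Qed.
Lemma hcomp_sum d I (r : seq I) (P : pred I) (F : I -> alg) :
  hcomp d (\sum_(t <- r | P t) F t) = \sum_(t <- r | P t) hcomp d (F t).
Proof. exact: (big_morph (hcomp d) (hcompD d) (hcomp_zero d)). Qed.

Lemma hcomp_vertexM d i x : hcomp d (vertex K Q i * x) = vertex K Q i * hcomp d x.
Proof.
apply: cpalgP => p; rewrite coef_vertexM !coef_hcomp coef_vertexM.
by case: ifP; rewrite ?mulr0.
Qed.

Lemma ldiv_hcompS a d x : ldiv a (hcomp d.+1 x) = hcomp d (ldiv a x).
Proof.
apply: cpalgP => p /=; case: (tgt a =P _) => [ap|]; last by rewrite if_same.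
by rewrite plen_pcons // eqSS.
Qed.

Lemma hcomp_arrowMS a d y :
  hcomp d.+1 (arrow_elt K a * y) = arrow_elt K a * hcomp d y.
Proof.
apply: series_eq => [i|b]; first by rewrite c0M c0_arrow mul0r.
by rewrite ldiv_hcompS !ldiv_arrowM hcompZ hcomp_vertexM.
Qed.

Lemma hcomp_aspanMS u d y :
  hcomp d.+1 (aspan_elt u * y) = aspan_elt u * hcomp d y.
Proof.
rewrite aspan_eltE !mulr_suml hcomp_sum; apply: eq_bigr => a _.
by rewrite -!cpscaleAl hcompZ hcomp_arrowMS.
Qed.

Lemma cpart_hcomp x : cpart x = hcomp 0 x.
Proof.
apply: series_eq => [i|a]; first by rewrite c0_cpart.
rewrite ldiv_cpart; apply: cpalgP => p /=; case: (tgt a =P _) => // ap.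
by rewrite plen_pcons.
Qed.

Lemma hcomp_cpart d x : hcomp d (cpart x) = (d == 0%N)%:R *: cpart x.
Proof.
rewrite cpart_hcomp; apply: cpalgP => p; rewrite scoefZ !coef_hcomp.
case: (eqVneq (plen p) d) => [->|pd]; first by case: eqP; rewrite ?mul1r ?mulr0.
case: (eqVneq (plen p) 0%N) pd => [->|]; last by rewrite mulr0.
by rewrite eq_sym => /negPf->; rewrite mul0r.
Qed.

Lemma hcomp0_aspanM u y : hcomp 0 (aspan_elt u * y) = 0.
Proof.
apply: cpalgP => p /=; case: eqP => // p0.
have := deepM (deep_aspan_elt u) (deep0 y); apply; by rewrite p0.
Qed.

Lemma tensor_pow0 U d : tensor_pow U d 0.
Proof. by case: d => [|d]; exact: lspan0. Qed.
Lemma tensor_powZ U d c x : tensor_pow U d x -> tensor_pow U d (c *: x).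
Proof. by case: d => [|d]; exact: lspanZ. Qed.
Lemma tensor_pow_sum U d I (r : seq I) (P : pred I) (F : I -> alg) :
  (forall t, P t -> tensor_pow U d (F t)) ->
  tensor_pow U d (\sum_(t <- r | P t) F t).
Proof. by case: d => [|d]; exact: lspan_sum. Qed.

Lemma tensor_powM U d u y : u \in U -> tensor_pow U d y ->
  tensor_pow U d.+1 (aspan_elt u * y).
Proof. by move=> uU dy; apply: lspan_mem; exists u => //; exists y. Qed.

Lemma tensor_pow0_cpart U x : tensor_pow U 0 (cpart x).
Proof.
by apply: lspan_sum => i _; apply/lspanZ/lspan_mem; exists i.
Qed.

Lemma hcomp_tensor U d e x :
  tensor_pow U e x -> hcomp d x = (d == e)%:R *: x.
Proof.
elim: e d x => [|e IH] d x /= [s [sP ->]]; rewrite hcomp_sum scaler_sumr;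
  apply: eq_big_seq => t /sP; rewrite hcompZ scalerA mulrC -scalerA.
  by move=> [i _ <-]; rewrite -(cpart_vertex K Q i) hcomp_cpart.
move=> [u _ [y yU <-]]; congr (_ *: _); case: d => [|d].
  by rewrite hcomp0_aspanM scale0r.
by rewrite hcomp_aspanMS (IH d y yU) eqSS -cpscaleAr.
Qed.

Lemma tensor_pow_completed U e x : tensor_pow U e x -> completed_tensor U x.
Proof.
move=> Ux d; rewrite (hcomp_tensor d Ux); case: eqP => [->|_].
  exact: tensor_powZ.
by rewrite scale0r; exact: tensor_pow0.
Qed.

Lemma completed_subst U (v : arrow Q -> A) x : (forall a, v a \in U) ->
  completed_tensor U (subst (fun a => aspan_elt (v a)) x).
Proof.
move=> vU d; have v1 a := deep_aspan_elt (v a).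
elim: d x => [|d IH] x; rewrite (substE v1) hcompD hcomp_cpart hcomp_sum.
  rewrite big1 ?addr0 => [|a _]; last exact: hcomp0_aspanM.
  exact/tensor_powZ/tensor_pow0_cpart.
rewrite scale0r add0r; apply: tensor_pow_sum => a _.
by rewrite hcomp_aspanMS; exact: tensor_powM.
Qed.

End Tensor.

(** * The trivial part *)

Section TrivialPart.
Variables (K : fieldType) (G : groupType) (n : nat) (Q : wquiver G n).
Local Notation alg := (cpalg K Q).
Local Notation A := (aspan K Q).
Implicit Types (x y z : alg) (i j : 'I_n) (a b : arrow Q) (g h : G).
Implicit Types (u v : A).
Variable S : alg.
Hypothesis potS : potential S.

(** The derivative with respect to [b] of the quadratic part of [S], up to
    cyclic equivalence: the contraction of [S_g^ij] against the coordinate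
    [b]. *)
Definition qderiv b : A := \sum_a sym_coef2 S a b *: delta K a.

Lemma sym_coef2_in a b i j g : a \in arrows_from_to i j g ->
  sym_coef2 S a b != 0 -> b \in arrows_from_to j i g^-1%g.
Proof.
move=> /and3P[/eqP<- /eqP<- /eqP<-] /(sym_coef2_neq0 potS)[ba ab wab].
by apply/and3P; rewrite ba ab wab.
Qed.

Lemma qderiv_in b i j g : b \in arrows_from_to j i g^-1%g ->
  qderiv b = \sum_(a in arrows_from_to i j g) sym_coef2 S a b *: delta K a.
Proof.
move=> bP; rewrite [RHS]big_mkcond; apply: eq_bigr => a _.
case: ifPn => // aP; rewrite (_ : sym_coef2 S a b = 0) ?scale0r //.
apply: contraNeq aP; rewrite sym_coef2C => /(sym_coef2_in bP).
by rewrite invgK.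
Qed.

(** The derivative is the image of the coordinate function of [b] under the
    contraction. *)
Lemma qderiv_Vtriv b i j g : b \in arrows_from_to j i g^-1%g ->
  qderiv b \in Vtriv S i j g.
Proof.
move=> bP; pose f (u : subvs_of (eAe K Q j i g^-1%g)) : K^o := (vsval u) b.
have f_lin : linear f by move=> c u v; rewrite /f linearP !ffunE.
pose fL : {linear subvs_of (eAe K Q j i g^-1%g) -> K^o} :=
  HB.pack f (GRing.isLinear.Build K _ _ _ f f_lin).
have fE (u : subvs_of (eAe K Q j i g^-1%g)) : linfun f u = f u by exact: (lfunE fL).
apply/memv_imgP; exists (linfun f); first exact: memvf.
rewrite lfunE /= /contraction (qderiv_in bP); apply: eq_bigr => a aP.
rewrite (bigD1 b) //= big1 ?addr0 => [|b' /andP[b'P b'b]].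
  rewrite fE /f vsprojK; last first.
    by case/and3P: bP => /eqP<- /eqP<- /eqP<-; exact: delta_eAe.
  by rewrite ffunE eqxx mulr1.
rewrite fE /f vsprojK; last first.
  by case/and3P: b'P => /eqP<- /eqP<- /eqP<-; exact: delta_eAe.
by rewrite ffunE eq_sym (negPf b'b) mulr0 scale0r.
Qed.

Lemma Vtriv_qderiv i j g v : v \in Vtriv S i j g ->
  exists d : arrow Q -> K,
    (forall b, d b != 0 -> b \in arrows_from_to j i g^-1%g) /\
    v = \sum_b d b *: qderiv b.
Proof.
move=> /memv_imgP[f _ ->]; rewrite lfunE /= /contraction.
exists (fun b => if b \in arrows_from_to j i g^-1%g
   then f (vsproj _ (delta K b)) else 0); split.
  by move=> b; case: ifP => // _; rewrite eqxx.
rewrite exchange_big [LHS]big_mkcond; apply: eq_bigr => b _ /=.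
case: ifP => bP; last by rewrite scale0r.
rewrite (qderiv_in bP) scaler_sumr; apply: eq_bigr => a _.
by rewrite scalerA mulrC.
Qed.

Variable W : 'I_n -> 'I_n -> G -> {vspace A}.
Hypothesis WV : forall i j g, (Vtriv S i j g + W i j g)%VS = eAe K Q i j g /\
  (Vtriv S i j g :&: W i j g)%VS = 0%VS.

Lemma cap_WV i j g : (W i j g :&: Vtriv S i j g)%VS = 0%VS.
Proof. by rewrite capvC; have [_] := WV i j g. Qed.

Lemma Vtriv_eAe i j g v : v \in Vtriv S i j g -> v \in eAe K Q i j g.
Proof. by have [<- _] := WV i j g; apply/subvP/addvSl. Qed.

Lemma W_eAe i j g v : v \in W i j g -> v \in eAe K Q i j g.
Proof. by have [<- _] := WV i j g; apply/subvP/addvSr. Qed.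

Definition redproj i j g : 'End(A) := daddv_pi (W i j g) (Vtriv S i j g).
Definition trivproj i j g : 'End(A) := daddv_pi (Vtriv S i j g) (W i j g).

Lemma redproj_add i j g v : v \in eAe K Q i j g ->
  redproj i j g v + trivproj i j g v = v.
Proof.
move=> vA; apply: daddv_pi_add; first exact: cap_WV.
by rewrite addvC; have [-> _] := WV i j g.
Qed.

Lemma redproj_triv i j g v : v \in Vtriv S i j g -> redproj i j g v = 0.
Proof.
move=> vV; have := redproj_add (Vtriv_eAe vV).
rewrite [X in _ + X]daddv_pi_id //; last by have [_] := WV i j g.
by move/eqP; rewrite eq_sym -subr_eq subrr eq_sym => /eqP.
Qed.

Definition redarrow a : A := redproj (src a) (tgt a) (wt a) (delta K a).
Definition trivarrow a : A := trivproj (src a) (tgt a) (wt a) (delta K a).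

Lemma redarrow_W a : redarrow a \in W (src a) (tgt a) (wt a).
Proof. exact: memv_pi. Qed.

Lemma trivarrow_V a : trivarrow a \in Vtriv S (src a) (tgt a) (wt a).
Proof. exact: memv_pi. Qed.

Lemma arrow_splitE a :
  arrow_elt K a = aspan_elt (redarrow a) + aspan_elt (trivarrow a).
Proof.
by rewrite -linearD /redarrow /trivarrow redproj_add ?delta_eAe //= aspan_elt_delta.
Qed.

Lemma wt_weights a : wt a \in weights Q.
Proof. by rewrite mem_undup map_f ?mem_enum. Qed.

Lemma redarrow_Wtotal a : redarrow a \in Wtotal W.
Proof.
apply: subvP (redarrow_W a).
apply: (sumv_sup (src a)) => //; apply: (sumv_sup (tgt a)) => //.
by rewrite (big_rem (wt a)) ?wt_weights //=; exact: addvSl.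
Qed.

(** The matrix of [S_g^ij] is the same whether it is contracted on the left or
    on the right, so the projection that kills its columns kills its rows, and
    both factors may be projected to the trivial part. *)
Lemma Spart_triv i j g : Spart S i j g =
  \sum_(b in arrows_from_to j i g^-1%g)
    aspan_elt (qderiv b) * aspan_elt (trivarrow b).
Proof.
have -> : Spart S i j g = \sum_(b in arrows_from_to j i g^-1%g)
    aspan_elt (qderiv b) * arrow_elt K b.
  rewrite /Spart exchange_big; apply: eq_bigr => b bP.
  rewrite (qderiv_in bP) linear_sum mulr_suml; apply: eq_bigr => a _ /=.
  by rewrite linearZ /= aspan_elt_delta cpscaleAl.
under eq_bigr => b _ do rewrite arrow_splitE mulrDr.
rewrite big_split /= [X in X + _](_ : _ = 0) ?add0r //.
transitivity (\sum_(a in arrows_from_to i j g) arrow_elt K a *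
    aspan_elt (redproj j i g^-1%g (qderiv a))).
  under eq_bigr => b bP.
    rewrite (qderiv_in bP) linear_sum mulr_suml.
    under eq_bigr => a _ do rewrite /= linearZ /= aspan_elt_delta -cpscaleAl cpscaleAr -linearZ /=.
    over.
  rewrite exchange_big; apply: eq_bigr => a aP /=.
  rewrite -mulr_sumr -linear_sum; congr (_ * aspan_elt _).
  have aP' : a \in arrows_from_to i j g^-1^-1%g by rewrite invgK.
  rewrite (qderiv_in aP') linear_sum; apply: eq_bigr => b bP /=.
  rewrite linearZ /= sym_coef2C /redarrow; congr (_ *: _).
  by case/and3P: bP => /eqP-> /eqP-> /eqP->.
apply: big1 => a aP; rewrite redproj_triv ?linear0 ?mulr0 //.
by apply: qderiv_Vtriv; rewrite invgK.
Qed.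

Lemma Vtriv_Atriv i j g v : (i < j)%N -> g \in weights Q ->
  v \in Vtriv S i j g -> v \in Atriv S.
Proof.
move=> ij gw; apply/subvP; apply: (sumv_sup i) => //; apply: (sumv_sup j) => //.
by rewrite (big_rem g) //=; apply: subv_trans (addvSl _ _); exact: addvSl.
Qed.

Lemma VtrivV_Atriv i j g v : (i < j)%N -> g \in weights Q ->
  v \in Vtriv S j i g^-1%g -> v \in Atriv S.
Proof.
move=> ij gw; apply/subvP; apply: (sumv_sup i) => //; apply: (sumv_sup j) => //.
by rewrite (big_rem g) //=; apply: subv_trans (addvSl _ _); exact: addvSr.
Qed.

Lemma tensor_pow_Striv : tensor_pow (Atriv S) 2 (Striv S).
Proof.
apply: tensor_pow_sum => i _; apply: tensor_pow_sum => j ij.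
rewrite big_seq; apply: tensor_pow_sum => g gw; rewrite Spart_triv.
apply: tensor_pow_sum => b bP; apply: tensor_powM.
  exact/(Vtriv_Atriv ij gw)/qderiv_Vtriv.
rewrite -[aspan_elt _]mulr1 -cpart_one; apply: tensor_powM (tensor_pow0_cpart _ _).
apply: (VtrivV_Atriv ij gw); have := trivarrow_V b.
by case/and3P: bP => /eqP-> /eqP-> /eqP->.
Qed.

Lemma potential_Striv : potential (Striv S).
Proof.
have cS : cyclic (Striv S).
  apply: cyclic_sum => i _; apply: cyclic_sum => j _; apply: cyclic_sum => g _.
  apply: cyclic_sum => a aP; apply: cyclic_sum => b bP; apply: cyclicZ.
  apply: (@homog_cyclic _ _ _ _ i); rewrite -(mulgV g).
  apply: (@homogM _ _ _ _ _ j).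
    by case/and3P: aP => /eqP<- /eqP<- /eqP<-; exact: homog_arrow.
  by case/and3P: bP => /eqP<- /eqP<- /eqP<-; exact: homog_arrow.
move=> p Sp; have [-> ->] := cS p Sp; rewrite !eqxx /= andbT lt0n.
apply: contra Sp => /eqP p0.
have := hcomp_tensor 0 tensor_pow_Striv; rewrite scale0r.
by move/(congr1 (fun x => coef x p)); rewrite coef_hcomp p0 eqxx => ->.
Qed.

(** Each arrow that increases the vertex lies in one summand only, and the
    support of the coefficients confines the second factor. *)
Lemma StrivE : Striv S = \sum_(a | (src a < tgt a)%N) \sum_b
  sym_coef2 S a b *: (arrow_elt K a * arrow_elt K b).
Proof.
rewrite (partition_big (@src _ _ Q) xpredT) //; apply: eq_bigr => i _.
rewrite (partition_big (@tgt _ _ Q) (fun j : 'I_n => i < j)%N) /=; last first.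
  by move=> a /andP[+ /eqP<-].
apply: eq_bigr => j ij.
rewrite [RHS](eq_bigl (fun a => (src a == i) && (tgt a == j))); last first.
  move=> a; rewrite -andbA andb_idl // => /andP[/eqP-> /eqP->] //.
under eq_bigr => g _ do rewrite /Spart big_mkcond.
rewrite exchange_big [RHS]big_mkcond; apply: eq_bigr => a _ /=.
rewrite (bigD1_seq (wt a)) ?undup_uniq ?wt_weights //= [X in _ + X]big1 => [|g ga]; last first.
  by rewrite ?inE [wt a == g]eq_sym (negPf ga) !andbF.
rewrite ?inE eqxx andbT addr0; case: ifP => // /andP[/eqP ai /eqP aj].
rewrite [LHS]big_mkcond; apply: eq_bigr => b _; case: ifPn => // bP.
rewrite (_ : sym_coef2 S a b = 0) ?scale0r //.
apply: contraNeq bP; apply: sym_coef2_in.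
by apply/and3P; rewrite ai aj !eqxx.
Qed.

(** In a cycle of length 2 exactly one arrow increases the vertex; the product
    is rotated when it is the second one. *)
Lemma cyc0_quad_Striv : cyc0 (quad S - Striv S).
Proof.
pose lt a := (src a < tgt a)%N.
have -> : quad S - Striv S = \sum_a \sum_b coef2 S a b *: (
    arrow_elt K a * arrow_elt K b - (lt a)%:R *: (arrow_elt K a * arrow_elt K b)
    - (lt b)%:R *: (arrow_elt K b * arrow_elt K a)).
  have -> : Striv S = \sum_a \sum_b
     coef2 S a b *: ((lt a)%:R *: (arrow_elt K a * arrow_elt K b) +
       (lt b)%:R *: (arrow_elt K b * arrow_elt K a)).
    under [RHS]eq_bigr => a _ do under eq_bigr => b _ do rewrite scalerDr.
    under [RHS]eq_bigr => a _ do rewrite big_split.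
    rewrite big_split /= [X in _ + X]exchange_big -big_split StrivE big_mkcond.
    apply: eq_bigr => a _ /=; rewrite -big_split /= -/(lt a); case: (lt a).
      by apply: eq_bigr => b _; rewrite !scale1r -scalerDl.
    by rewrite big1 // => b _; rewrite !scale0r !scaler0 addr0.
  rewrite -sumrB; apply: eq_bigr => a _; rewrite -sumrB; apply: eq_bigr => b _.
  by rewrite -scalerBr opprD addrA.
apply: cyc0_sum => a _; apply: cyc0_sum => b _.
case: (eqVneq (coef2 S a b) 0) => [->|/(coef2_neq0 potS)[ba ab _]].
  by rewrite scale0r; exact: cyc0_zero.
apply: cyc0Z; rewrite /lt ba ab; have := noloop a; rewrite -val_eqE /=.
case: ltngtP => // _ _.
  by rewrite scale1r scale0r subrr subr0; exact: cyc0_zero.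
rewrite scale1r scale0r subr0.
by apply: (cyc0_comm (homog_arrow K a)); rewrite -ba -ab; exact: homog_arrow.
Qed.

Lemma splitting_theorem : exists (phi : alg -> alg) (Sred : alg),
    [/\ graded_automorphism phi,
        unitriangular phi,
        potential_on (Atriv S) (Striv S),
        potential_on (Wtotal W) Sred /\
          (forall p, coef Sred p != 0 -> (3 <= plen p)%N)
      & cyc_equiv (phi S) (Striv S + Sred)].
Proof.
have /choice[c cP] a := Vtriv_qderiv (trivarrow_V a).
pose w a := aspan_elt (redarrow a).
have w1 a : deep 1 (w a) by exact: deep_aspan_elt.
have wh a : homog (src a) (tgt a) (wt a) (w a).
  exact/homog_eAe/W_eAe/redarrow_W.
have ddE b : aspan_elt (qderiv b) = \sum_a sym_coef2 S a b *: arrow_elt K a.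
  rewrite linear_sum; apply: eq_bigr => a _ /=.
  by rewrite linearZ /= aspan_elt_delta.
have ch a b : c a b != 0 ->
    [/\ src b = tgt a, tgt b = src a & wt b = (wt a)^-1%g].
  by have [+ _] := cP a => /[apply] /and3P[/eqP-> /eqP-> /eqP->].
have split a : arrow_elt K a = w a + \sum_b c a b *: aspan_elt (qderiv b).
  rewrite arrow_splitE; have [_ ->] := cP a; rewrite linear_sum; congr (_ + _).
  by apply: eq_bigr => b _ /=; rewrite linearZ.
have [F [X [F2 Fh Xc X3 FS]]] := splitting potS w1 wh ddE ch split.
have F1 := unitri_deep1 F2.
have r3 : deep 3 (subst w X) by exact: deep_subst.
exists (subst F), (subst w X); split.
- split.
  + exact: subst_is_linear.
  + by split; [exact: subst_one|move=> x y; exact: substM].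
  + exact: subst_bij.
  + exact: subst_vertex.
  + move=> g v /span_delta ->; rewrite subst_sum // => p.
    apply: contraPeq => pg; apply/negP; rewrite negbK scoef_sum big1 // => a.
    rewrite inE => /eqP ag; rewrite substZ // subst_arrow // scoefZ.
    case: (eqVneq (coef (F a) p) 0) => [->|/Fh[_ _ e]]; first by rewrite mulr0.
    by rewrite e ag eqxx in pg.
- by move=> x; apply: maxideal_pow_deep; exact: deep2_subst_unitri.
- split; last exact: potential_Striv.
  exact: tensor_pow_completed tensor_pow_Striv.
- have long p : coef (subst w X) p != 0 -> (3 <= plen p)%N.
    by apply: contraNT; rewrite -ltnNge => /r3/eqP.
  split=> //; split; first exact/completed_subst/redarrow_Wtotal.
  move=> p rp; have [-> ->] := cyclic_subst w1 wh Xc rp.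
  by rewrite !eqxx !andbT (leq_trans _ (long p rp)).
apply: cyc0_equiv.
rewrite -(subrK (quad S + subst w X) (subst F S)) -addrA.
apply: cyc0D => //; rewrite opprD addrACA subrr addr0.
exact: cyc0_quad_Striv.
Qed.

End TrivialPart.

Theorem proposition2p5p2 (R : realType) (G : groupType) (n : nat)
    (Q : wquiver G n) (S : cpalg (complex R) Q)
    (W : 'I_n -> 'I_n -> G -> {vspace aspan (complex R) Q}) :
  weighted_qp S ->
  (forall i j g,
     (Vtriv S i j g + W i j g)%VS = eAe (complex R) Q i j g /\
     (Vtriv S i j g :&: W i j g)%VS = 0%VS) ->
  exists (phi : cpalg (complex R) Q -> cpalg (complex R) Q)
         (Sred : cpalg (complex R) Q),
    [/\ graded_automorphism phi,
        unitriangular phi,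
        potential_on (Atriv S) (Striv S),
        potential_on (Wtotal W) Sred /\
          (forall p, coef Sred p != 0 -> (3 <= plen p)%N)
      & cyc_equiv (phi S) (Striv S + Sred)].
Proof. by move=> [potS _]; exact: splitting_theorem. Qed.
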